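(* Let $(X,d,\mu)$ be a doubling metric measure space, and let $\alpha>0$ and $q\in(1,\infty)$. Then the pairing $$\langle f,g\rangle := \iint_{X^+} f(y,t)\,\overline{g(y,t)}\,d\mu(y)\,\frac{dt}{t}\qquad (f\in T^{1,q,\alpha}(X),\ g\in T^{\infty,q',\alpha}(X))$$ realises $T^{\infty,q',\alpha}(X)$ as the Banach space dual of $T^{1,q,\alpha}(X)$, up to equivalence of norms. That is: for every $g\in T^{\infty,q',\alpha}(X)$ the integral $\langle f,g\rangle$ converges absolutely for all $f\in T^{1,q,\alpha}(X)$ and $f\mapsto\langle f,g\rangle$ is a bounded linear functional on $T^{1,q,\alpha}(X)$; every bounded linear functional on $T^{1,q,\alpha}(X)$ is of this form for a unique $g\in T^{\infty,q',\alpha}(X)$; and the norm of the functional is equivalent to $\|g\|_{T^{\infty,q',\alpha}(X)}$, with constants independent of $g$.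
   Context: A metric measure space $(X,d,\mu)$ is a metric space $(X,d)$ with a Borel measure $\mu$. Write $B(x,r)=\{y\in X: d(x,y)<r\}$ and $V(x,r)=\mu(B(x,r))$; it is assumed throughout that $0<V(x,r)<\infty$ for all $x\in X$, $r>0$. $X$ is *doubling* if there is $C>0$ with $V(x,2r)\le C\,V(x,r)$ for all $x\in X$, $r>0$. Let $X^+:=X\times(0,\infty)$ with the product topology and the measure $d\mu(y)\,dt/t$. For $x\in X$, $\alpha>0$ the cone is $\Gamma^\alpha(x):=\{(y,t)\in X^+: d(x,y)<\alpha t\}$; for $F\subset X$, $\Gamma^\alpha(F):=\bigcup_{x\in F}\Gamma^\alpha(x)$; for $O\subset X$ the tent over $O$ is $T^\alpha(O):=X^+\setminus\Gamma^\alpha(X\setminus O)$. For $q\in(0,\infty)$ and measurable $f:X^+\to\mathbb{C}$, $$\mathcal{A}_q^\alpha(f)(x):=\left(\iint_{\Gamma^\alpha(x)}|f(y,t)|^q\,\frac{d\mu(y)}{V(y,\alpha t)}\,\frac{dt}{t}\right)^{1/q},\qquad \mathcal{C}_q^\alpha(f)(x):=\sup_{B\ni x}\left(\frac{1}{\mu(B)}\iint_{T^\alpha(B)}|f(y,t)|^q\,d\mu(y)\,\frac{dt}{t}\right)^{1/q},$$ the supremum being over all balls $B$ containing $x$. For $p\in(0,\infty)$, $\|f\|_{T^{p,q,\alpha}(X)}:=\|\mathcal{A}_q^\alpha(f)\|_{L^p(X)}$, and $\|f\|_{T^{\infty,q,\alpha}(X)}:=\|\mathcal{C}_q^\alpha(f)\|_{L^\infty(X)}$;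 $T^{p,q,\alpha}(X)$ ($p\in(0,\infty]$) is the space of measurable $f:X^+\to\mathbb{C}$ (modulo a.e. equality) with finite norm. For $q\in(1,\infty)$, $q':=q/(q-1)$. *)

(* Defs.v *)
From HB Require Import structures.
From mathcomp Require Import all_boot all_order all_algebra.
From mathcomp Require Import all_classical all_reals all_analysis.
From mathcomp Require Import measurable_realfun ess_sup_inf complex.
Set Implicit Arguments.
Unset Strict Implicit.
Unset Printing Implicit Defensive.
Import Order.TTheory GRing.Theory Num.Theory.
Import numFieldNormedType.Exports.
Local Open Scope classical_set_scope.
Local Open Scope ring_scope.

(* Measurable types of the library are inhabited, so the Borel sigma-algebra   *)
(* is only available on pointed spaces; the base point plays no other role.    *)
#[short(type="pmetricType")]
HB.structure Definition PointedMetric (K : numDomainType) :=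
  { M of PseudoPointedMetric K M & Metric K M }.

Notation normc := ComplexField.Normc.normc.
Notation borel X := (g_sigma_algebraType (@open X)).

Section dt_over_t.
Context {R : realType}.

(* The measure dt/t on (0, +oo), extended by zero to a Borel measure on R.     *)
Definition dt_over_t (A : set (measurableTypeR R)) : \bar R :=
  (\int[lebesgue_measure]_(t in A `&` `]0%R, +oo[) (t^-1)%:E)%E.

Let posI (A : set (measurableTypeR R)) (t : R) : (A `&` `]0, +oo[) t -> 0 < t.
Proof. by case=> _ /=; rewrite in_itv/= andbT. Qed.

Let inv_ge0 (A : set (measurableTypeR R)) (t : R) :
  (A `&` `]0, +oo[) t -> (0 <= (t^-1)%:E)%E.
Proof. by move=> /posI t0; rewrite lee_fin invr_ge0 ltW. Qed.

Let dt_over_t0 : dt_over_t set0 = 0%E.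
Proof. by rewrite /dt_over_t set0I integral_set0. Qed.

Let dt_over_t_ge0 A : (0 <= dt_over_t A)%E.
Proof. by apply: integral_ge0 => t /inv_ge0. Qed.

Let measurable_inv_pos :
  @measurable_fun _ _ (measurableTypeR R) (\bar R) `]0%R, +oo[
    (fun t => (t^-1)%:E).
Proof.
apply/measurable_EFinP; apply: subspace_continuous_measurable_fun => //.
rewrite continuous_open_subspace; last exact: interval_open.
move=> t; rewrite inE/= in_itv/= andbT => t0.
by apply: inv_continuous; rewrite gt_eqF.
Qed.

Let dt_over_t_sigma_additive : semi_sigma_additive dt_over_t.
Proof.
move=> /= F mF tF mUF; rewrite /dt_over_t; apply: cvg_toP.
  apply: ereal_nondecreasing_is_cvgn => m n mn.
  apply: lee_sum_nneg_natr => // k _ _.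
  by apply: integral_ge0 => t /inv_ge0.
rewrite setI_bigcupl ge0_integral_bigcup//=.
- by move=> k; exact: measurableI.
- rewrite -setI_bigcupl; apply: measurable_funS measurable_inv_pos => //.
- by rewrite -setI_bigcupl => t /inv_ge0.
- exact: trivIset_setIr.
Qed.

HB.instance Definition _ := isMeasure.Build _ _ _ dt_over_t
  dt_over_t0 dt_over_t_ge0 dt_over_t_sigma_additive.

Let dt_over_t_sigma_finite : sigma_finite setT dt_over_t.
Proof.
exists (fun n => `]-oo, 0%R] `|` `[n.+1%:R^-1, n.+1%:R]).
  apply/esym; rewrite -subTset => t _; have [t0|t0] := leP t 0.
    by exists 0%N => //; left; rewrite /= in_itv.
  have [n [ltn lVn]] : exists n, t <= n.+1%:R /\ t^-1 <= n.+1%:R.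
    exists (maxn (Num.truncn t) (Num.truncn t^-1)).
    split; apply: le_trans (ltW (truncnS_gt _)) _; rewrite ler_nat ltnS.
      exact: leq_maxl.
    exact: leq_maxr.
  exists n => //; right; rewrite /= in_itv/= ltn andbT.
  by rewrite invf_ple ?posrE.
move=> n; split; first exact: measurableU.
rewrite /dt_over_t setIUl (_ : _ `&` _ = set0) ?set0U; last first.
  rewrite -subset0 => t [] /=; rewrite !in_itv/= andbT => t0.
  by rewrite ltNge t0.
rewrite setIidl; last first.
  move=> t /=; rewrite !in_itv/= andbT => /andP[+ _].
  by apply: lt_le_trans; rewrite invr_gt0.
set D := (X in integral _ X _); pose c : R := n.+1%:R.
have D_ge t : D t -> c^-1 <= t by rewrite /D /= in_itv/= => /andP[].
have D_gt0 t : D t -> 0 < t by move/D_ge; apply: lt_le_trans; rewrite invr_gt0.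
have mD : measurable (D : set (measurableTypeR R)) by exact: measurable_itv.
have le_int : (\int[lebesgue_measure]_(t in D) (t^-1)%:E
    <= \int[lebesgue_measure]_(t in D) (cst c%:E) t)%E.
  apply: ge0_le_integral => //.
  - by move=> t /D_gt0 t0; rewrite lee_fin invr_ge0 ltW.
  - apply: measurable_funS measurable_inv_pos => // t /D_gt0 t0.
    by rewrite /= in_itv/= andbT.
  - move=> t Dt; rewrite lee_fin -(invrK c) lef_pV2 ?posrE ?invr_gt0 ?D_ge//.
    exact: D_gt0.
apply: le_lt_trans le_int _.
rewrite integral_cst//= lebesgue_measure_itv/=; case: ifP => _.
  by rewrite -EFinD -EFinM ltry.
by rewrite mule0.
Qed.

HB.instance Definition _ := @Measure_isSigmaFinite.Build _ _ _ dt_over_t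
  dt_over_t_sigma_finite.

End dt_over_t.

Section tent_spaces.
Context {R : realType} (X : pmetricType R)
  (mu : {measure set (borel X) -> \bar R}).

Definition doubling := exists2 C : R, 0 < C &
  forall (x : X) (r : R), 0 < r -> (mu (ball x (2 * r)) <= C%:E * mu (ball x r))%E.

(* X x (0, +oo) as a subset of X x R. When X is separable (which doubling      *)
(* implies) the product sigma-algebra is the Borel sigma-algebra of the        *)
(* product topology.                                                           *)
Definition halfspace : set (borel X * measurableTypeR R) := [set p | 0 < p.2].

Definition halfspace_measure : set (borel X * measurableTypeR R) -> \bar R :=
  (mu \x dt_over_t)%E.

HB.instance Definition _ := Measure.on halfspace_measure.

Definition cone (alpha : R) (x : X) : set (borel X * measurableTypeR R) :=
  [set p | halfspace p /\ mdist x (p.1 : X) < alpha * p.2].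

Definition tent (alpha : R) (O : set X) : set (borel X * measurableTypeR R) :=
  halfspace `\` \bigcup_(x in ~` O) cone alpha x.

Implicit Types f g : borel X * measurableTypeR R -> R[i].

Definition Aq (q alpha : R) f (x : borel X) : \bar R :=
  ((\int[halfspace_measure]_(p in cone alpha x)
      ((normc (f p) `^ q)%:E / mu (ball (p.1 : X) (alpha * p.2)))) `^ q^-1)%E.

Definition Cq (q alpha : R) f (x : borel X) : \bar R :=
  ereal_sup
    [set (((\int[halfspace_measure]_(p in tent alpha (ball b.1 b.2))
              (normc (f p) `^ q)%:E) / mu (ball b.1 b.2)) `^ q^-1)%E |
      b in [set b : X * R | 0 < b.2 /\ ball b.1 b.2 (x : X)]].

(* Meaningful for 0 < p <= +oo.                                                *)
Definition tent_norm (p : \bar R) (q alpha : R) f : \bar R :=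
  match p with
  | +oo%E => 'N[mu]_+oo[Cq q alpha f]%E
  | _ => 'N[mu]_p[Aq q alpha f]%E
  end.

(* Representatives; two of them are identified when equal a.e. on X x (0,+oo). *)
Definition tent_space (p : \bar R) (q alpha : R) :
    set (borel X * measurableTypeR R -> R[i]) :=
  [set f | [/\ measurable_fun halfspace (fun z => complex.Re (f z)),
               measurable_fun halfspace (fun z => complex.Im (f z)) &
               (tent_norm p q alpha f < +oo)%E]].

Definition pairing f g : R[i] :=
  let h z := f z * conjc (g z) in
  Complex (\int[halfspace_measure]_(z in halfspace) complex.Re (h z))
          (\int[halfspace_measure]_(z in halfspace) complex.Im (h z)).

Definition pairing_converges f g :=
  (\int[halfspace_measure]_(z in halfspace) (normc (f z * conjc (g z)))%:E
     < +oo)%E.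

(* Functionals on the space of a.e. classes, given by their values on          *)
(* representatives; values outside of the tent space are irrelevant.           *)
Definition bounded_linear_functional (p : \bar R) (q alpha : R)
    (L : (borel X * measurableTypeR R -> R[i]) -> R[i]) : Prop :=
  [/\ forall f g, tent_space p q alpha f -> tent_space p q alpha g ->
        f = g %[ae halfspace_measure in halfspace] -> L f = L g,
      forall (a : R[i]) f g, tent_space p q alpha f -> tent_space p q alpha g ->
        L (fun z => a * f z + g z) = a * L f + L g &
      exists C : R, forall f, tent_space p q alpha f ->
        ((normc (L f))%:E <= C%:E * tent_norm p q alpha f)%E].

Definition functional_norm (p : \bar R) (q alpha : R)
    (L : (borel X * measurableTypeR R -> R[i]) -> R[i]) : \bar R :=
  ereal_sup [set (normc (L f))%:E |
    f in [set f | tent_space p q alpha f /\ (tent_norm p q alpha f <= 1)%E]].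

End tent_spaces.

(* Main.v *)
(* The boundedness of the pairing is proved without maximal functions.  Let G
   bound the Carleson norm of g and let A_t(x) be the q'-th power of the area
   function of g truncated at height t.  By Fubini, the average of A_{2t} over
   B(y, alpha t) is at most the Carleson average of |g|^q' over the tent on a
   dilated ball, hence O(G^q').  By Chebyshev, at least half of the vertices
   x of B(y, alpha t) satisfy A_{2t}(x) <= level = O(G^q').  So the integral of
   |f g| is at most twice its average over such good vertices, and Hoelder's
   inequality on the part of the cone at x that is good, over which |g|^q'
   integrates to at most level, gives O(G) times the area function of f.

   Conversely, a bounded functional is a countably additive function of the
   subsets of the pieces of an exhaustion, so Radon-Nikodym yields a density;
   testing on |g|^(q'-2) g cut off to tents gives the Carleson condition, and
   the cut-off functions are dense by dominated convergence. *)
Require Import Defs.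
From HB Require Import structures.
From mathcomp Require Import all_boot all_order all_algebra.
From mathcomp Require Import finmap.
From mathcomp Require Import all_classical all_reals all_analysis.
From mathcomp Require Import measurable_realfun ess_sup_inf complex.
From mathcomp Require Import ring lra.
Set Implicit Arguments.
Unset Strict Implicit.
Unset Printing Implicit Defensive.
Import Order.TTheory GRing.Theory Num.Theory.
Import numFieldNormedType.Exports.
Local Open Scope classical_set_scope.
Local Open Scope ring_scope.

(** * Separability and Borel sets of a metric measure space *)

(** Measurability is the first obstacle: the half-space carries a product sigma-algebra, on which a
    distance is measurable as a function of two points only under separability. Balls of positive
    finite measure make X separable. Then [incidence], the set of pairs of a vertex and a point of
    its cone, is measurable; cones and balls are its two families of sections, and each exchange of
    integrals is Tonelli's theorem on a subset of it. A vertex is tested at height 2t rather than t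
    because the good heights over x need not attain their supremum: some good height exceeds half of
    it, and its double then dominates every good height. For the converse, Hoelder's inequality on a
    tent is replaced by u^(1/q) <= lam + lam^(1-q) u, which is linear in u and integrates directly.
    A suitable lam lets half of the integral of |g|^q' be absorbed by the left-hand side; this
    requires that integral to be finite beforehand, so functions are cut in size as well as in
    support. The density of a functional is integrable only locally, hence it is built on disjoint
    layers and glued. *)

Section metric_borel.
Context {R : realType} {X : pmetricType R}.
Implicit Types (x y : X) (r : R).

Lemma open_mball x r : open (ball x r).
Proof.
rewrite openE => y; rewrite ballEmdist /= => xyr.
apply/nbhs_ballP; exists (r - mdist x y); rewrite /= ?subr_gt0// => z.
rewrite ballEmdist/= => yz; rewrite (le_lt_trans (metric_triangle _ y _))//.
lra.
Qed.

Lemma borel_open (A : set X) : open A -> measurable (A : set (borel X)).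
Proof. exact: sub_sigma_algebra. Qed.

Lemma measurable_mball x r : measurable (ball x r : set (borel X)).
Proof. by apply: borel_open; exact: open_mball. Qed.

Lemma measurable_mdist x :
  measurable_fun [set: borel X] (fun y : borel X => mdist x (y : X)).
Proof.
apply: (measurability _ (RGenInftyO.measurableE R)) => //.
move=> _ [_ [r ->] <-]; rewrite setTI.
have -> : (fun y : borel X => mdist x (y : X)) @^-1` `]-oo, r[ = ball x r.
  by rewrite ballEmdist; apply/seteqP; split => y /=; rewrite in_itv.
exact: measurable_mball.
Qed.

End metric_borel.

(** Each [F i] meets some [S m] in measure above some 1/(k+1). For fixed m and k only finitely many
    disjoint sets of that size fit into [S m], so E is a countable union of finite sets. *)
Lemma countable_disjoint_positive d (T : measurableType d) (R : realType)
    (mu : {sigma_finite_measure set T -> \bar R}) (I : choiceType) (E : set I)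
    (F : I -> set T) :
  trivIset E F -> (forall i, E i -> measurable (F i)) ->
  (forall i, E i -> (0 < mu (F i))%E) -> countable E.
Proof.
move=> tF mF F0.
have [S ST Sfin] := sigma_finiteT mu.
pose G m k := [set i | E i /\ (k.+1%:R^-1%:E < mu (F i `&` S m))%E].
have mS m : measurable (S m) by have [] := Sfin m.
have -> : E = \bigcup_m \bigcup_k G m k.
  apply/seteqP; split=> [i Ei|i [m _ [k _ []]]//].
  have [m Hm] : exists m, mu (F i `&` S m) != 0%E.
    apply: contrapT => /forallNP abs; have := F0 _ Ei.
    rewrite lt0e => /andP[/eqP + _]; apply.
    rewrite -(setIT (F i)) ST setI_bigcupr; apply: measure_negligible.
      by apply: bigcup_measurable => m _; apply: measurableI => //; exact: mF.
    apply: negligible_bigcup => m; apply/negligibleP.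
      by apply: measurableI => //; exact: mF.
    by have /negP/negPn/eqP := abs m.
  have Fm0 : (0 < mu (F i `&` S m))%E by rewrite lt0e Hm measure_ge0.
  exists m => //.
  have Fmfin : mu (F i `&` S m) \is a fin_num.
    rewrite ge0_fin_numE//; apply: le_lt_trans (Sfin m).2.
    by apply: le_measure; rewrite ?inE//; apply: measurableI => //; exact: mF.
  have := Fm0; rewrite -{1}(fineK Fmfin) lte_fin => /ltr_add_invr[k kk].
  exists k => //; split => //; rewrite -(fineK Fmfin) lte_fin.
  by rewrite add0r in kk.
apply: bigcup_countable => // m _; apply: bigcup_countable => // k _.
apply: finite_set_countable; apply: contrapT => infG.
have Smfin : mu (S m) \is a fin_num by rewrite ge0_fin_numE//; exact: (Sfin m).2.
(* Here N/(k+1) > mu (S m), so N disjoint sets of measure above 1/(k+1) cannot lie in [S m]. *)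
pose N := (Num.truncn (k.+1%:R * fine (mu (S m)))).+1.
have [B BG BN] := infinite_set_fset N infG.
have tB : trivIset [set` B] (fun i => F i `&` S m).
  move=> i j Bi Bj [x [[Fi _] [Fj _]]]; apply: tF; [exact: (BG _ Bi).1|exact: (BG _ Bj).1|].
  by exists x.
have mB i : [set` B] i -> measurable (F i `&` S m).
  by move=> Bi; apply: measurableI => //; exact: mF (BG _ Bi).1.
have mU : measurable (\bigcup_(i in [set` B]) (F i `&` S m)).
  by apply: fin_bigcup_measurable.
have : (mu (\bigcup_(i in [set` B]) (F i `&` S m)) <= mu (S m))%E.
  by apply: le_measure; rewrite ?inE// => x [i _ []].
rewrite content_fin_bigcup//.
apply/negP; rewrite -ltNge fsbig_finite//= set_fsetK.
apply: (@lt_le_trans _ _ (\sum_(i <- B) k.+1%:R^-1%:E)%E); last first.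
  rewrite big_seq [leRHS]big_seq; apply: lee_sum => i Bi.
  by apply: ltW; have [] := BG i Bi.
rewrite sumEFin big_const_seq count_predT iter_addr_0 -(fineK Smfin) lte_fin.
rewrite -[ltRHS]mulr_natl ltr_pdivlMr// mulrC.
apply: lt_le_trans (truncnS_gt _) _.
by rewrite ler_nat.
Qed.

Section separability.
Context {R : realType} {X : pmetricType R}
  (mu : {sigma_finite_measure set (borel X) -> \bar R}).
Hypothesis mu_gt0 : forall (x : X) (r : R), 0 < r -> (0 < mu (ball x r))%E.

(** For each k take a maximal disjoint family of balls of radius 1/(k+1). It is countable since
    balls have positive measure, and by maximality every point lies within 2/(k+1) of a centre. The
    sequence lists the centres for all k. *)
Lemma ex_dense_sequence : exists D : nat -> X,
  forall (x : X) (e : R), 0 < e -> exists n, ball (D n) e x.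
Proof.
have H (k : nat) : exists D : nat -> X, forall x, exists n, ball (D n) (2 * k.+1%:R^-1) x.
  have k0 : 0 < k.+1%:R^-1 :> R by rewrite invr_gt0.
  have [E [_ tE maxE]] := ex_maximal_disjoint_subcollection
    (fun x : X => ball x (k.+1%:R^-1 : R)) setT.
  have cE : countable E.
    apply: (@countable_disjoint_positive _ _ _ mu X E _ tE) => x Ex.
      exact: measurable_mball.
    exact: mu_gt0.
  have P (x : X) : exists2 z, E z & ball z (2 * k.+1%:R^-1) x.
    have [Ex|nEx] := pselect (E x).
      by exists x => //; apply: ballxx; rewrite mulr_gt0.
    apply: contrapT => nz; apply: (maxE (E `|` [set x])) => //.
      split; first by move=> z; left.
      by move=> /(_ x) abs; apply/nEx/abs; right.
    have nx z : E z -> ball z k.+1%:R^-1 `&` ball x k.+1%:R^-1 !=set0 -> False.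
      move=> Ez [w [zw /ball_sym xw]]; apply: nz; exists z => //.
      by rewrite mulr_natl mulr2n; exact: ball_triangle zw xw.
    move=> i j [Ei|->] [Ej|->]//.
    - exact: tE.
    - by move=> /nx -/(_ Ei).
    - by rewrite setIC => /nx -/(_ Ej).
  have [z0 Ez0 _] := P point.
  have /countable_injP[f finj] := cE.
  (* [f] numbers the centres injectively; a number that is not taken gets the junk value [z0]. *)
  exists (fun n => xget z0 [set z | E z /\ f z = n]) => x.
  have [z Ez zx] := P x; exists (f z).
  case: xgetP => [w _ [Ew fwz]|/(_ z)]; last by case.
  by have <- : z = w by apply: finj; rewrite ?inE.
have /choice[D HD] := H.
exists (fun n : nat => let: ij := odflt (0%N, 0%N) (choice.unpickle n) in D ij.1 ij.2).
move=> x e e0.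
have [k ke] := ltr_add_invr (divr_gt0 e0 (ltr0Sn _ 1)); rewrite add0r in ke.
have [n Dx] := HD k x.
exists (choice.pickle (k, n)); rewrite choice.pickleK /=.
by apply: le_ball Dx; rewrite mulrC -ler_pdivlMr// ltW.
Qed.

End separability.

(** * Tonelli's theorem over the sections of a set *)

Section sections_fubini.
Context d1 d2 (T1 : measurableType d1) (T2 : measurableType d2) (R : realType).
Variables (m1 : {sigma_finite_measure set T1 -> \bar R})
  (m2 : {sigma_finite_measure set T2 -> \bar R}).
Local Open Scope ereal_scope.

(** The domain [xsection S x] moves with x; the indicator of S moves this dependence into the
    integrand, where Tonelli's theorem applies. *)
Let section_fun (S : set (T1 * T2)) (phi : T2 -> \bar R) (z : T1 * T2) :=
  phi z.2 * (\1_S z)%:E.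

Let section_funE S phi x :
  \int[m2]_(p in xsection S x) phi p = \int[m2]_p section_fun S phi (x, p).
Proof.
rewrite integral_mkcond; apply: eq_integral => p _.
rewrite /section_fun patchE mem_xsection indicE/=; case: ifPn => _.
  by rewrite mule1.
by rewrite mule0.
Qed.

Let measurable_section_fun S phi : measurable S -> measurable_fun setT phi ->
  measurable_fun setT (section_fun S phi).
Proof.
move=> mS mphi; apply: emeasurable_funM.
  exact: measurableT_comp.
by apply/measurable_EFinP; exact: measurable_indic.
Qed.

Lemma measurable_integral_xsection S (phi : T2 -> \bar R) :
  measurable S -> measurable_fun setT phi -> (forall p, 0 <= phi p) ->
  measurable_fun [set: T1] (fun x => \int[m2]_(p in xsection S x) phi p).
Proof.
move=> mS mphi phi0; under eq_fun do rewrite section_funE.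
apply: (measurable_fun_fubini_tonelli_F (section_fun S phi)).
  exact: measurable_section_fun.
by move=> z; rewrite mule_ge0// lee_fin.
Qed.

Lemma integral_xsection S (phi : T2 -> \bar R) :
  measurable S -> measurable_fun setT phi -> (forall p, 0 <= phi p) ->
  \int[m1]_x \int[m2]_(p in xsection S x) phi p =
  \int[m2]_p (phi p * m1 (ysection S p)).
Proof.
move=> mS mphi phi0; under eq_integral do rewrite section_funE.
rewrite (fubini_tonelli (section_fun S phi)); last 2 first.
- exact: measurable_section_fun.
- by move=> z; rewrite mule_ge0// lee_fin.
apply: eq_integral => p _; rewrite /section_fun/=.
have mSp : measurable_fun [set: T1] (fun x => (\1_S (x, p) : R)%:E).
  apply/measurable_EFinP.
  exact: (measurableT_comp (measurable_indic _) (pair2_measurable _)).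
rewrite (ge0_integralZl _ _ mSp)//; congr (_ * _).
rewrite -(setIT (ysection S p)) -integral_indic//.
  by apply: eq_integral => x _; rewrite !indicE mem_ysection.
exact: measurable_ysection.
Qed.

End sections_fubini.

(** * The half-space, its cones and its tents *)

Section halfspace_geometry.
Context {R : realType} {X : pmetricType R}
  (mu : {sigma_finite_measure set (borel X) -> \bar R}) (alpha : R).
Hypothesis mu_ball : forall (x : X) (r : R), 0 < r ->
  (0 < mu (ball x r))%E /\ (mu (ball x r) < +oo)%E.
Hypothesis alpha_gt0 : 0 < alpha.

Local Notation P := (borel X * measurableTypeR R)%type.
Local Notation hs := (@halfspace R X).
Local Notation m := (halfspace_measure mu).
Local Notation VB p := (mu (ball (p.1 : X) (alpha * p.2))).

Let halfspace_measure_sigma_finite : sigma_finite setT m.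
Proof.
have [F FT Ffin] := sigma_finiteT mu.
have [G GT Gfin] := sigma_finiteT (@dt_over_t R).
pose ij (n : nat) := odflt (0%N, 0%N) (choice.unpickle n).
exists (fun n => F (ij n).1 `*` G (ij n).2).
  apply/seteqP; split=> // -[x t] _.
  have [i _ Fx] : (\bigcup_i F i) x by rewrite -FT.
  have [j _ Gt] : (\bigcup_i G i) t by rewrite -GT.
  by exists (choice.pickle (i, j)) => //; rewrite /ij choice.pickleK.
move=> n; have [[mF Foo] [mG Goo]] := (Ffin (ij n).1, Gfin (ij n).2).
split; first exact: measurableX.
by rewrite [m _](product_measure1E _ _ mF mG) lte_mul_pinfty// ge0_fin_numE.
Qed.

HB.instance Definition _ := @Measure_isSigmaFinite.Build _ _ _ m
  halfspace_measure_sigma_finite.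

(** All cones in one set: its x-sections are the cones, its p-sections the balls B(y, alpha t). The
    condition 0 < t is implied, a distance being nonnegative. *)
Definition incidence : set (borel X * P) :=
  [set z | mdist (z.1 : X) (z.2.1 : X) < alpha * z.2.2].

Lemma measurable_halfspace : measurable hs.
Proof.
rewrite /halfspace (_ : [set _ | _] = snd @^-1` `]0, +oo[).
  by rewrite -[_ @^-1` _]setTI; exact: measurable_snd.
by apply/seteqP; split => p /=; rewrite in_itv/= andbT.
Qed.

Lemma mdist_lt_halfspace (x y : X) (t : R) : mdist x y < alpha * t -> 0 < t.
Proof. by move=> h; rewrite -(pmulr_rgt0 _ alpha_gt0) (le_lt_trans _ h)// mdist_ge0. Qed.

Lemma coneE (x : X) : cone alpha x = xsection incidence x.
Proof.
apply/seteqP; split => p; first by move=> [_ ?]; apply/xsectionP.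
by move=> /xsectionP h; split => //; exact: mdist_lt_halfspace h.
Qed.

Lemma ysection_incidence (p : P) :
  ysection incidence p = ball (p.1 : X) (alpha * p.2).
Proof.
rewrite ballEmdist; apply/seteqP; split => x.
  by move=> /ysectionP; rewrite /incidence/= metric_sym.
by move=> h; apply/ysectionP; rewrite /incidence/= metric_sym.
Qed.

Lemma measurable_mdist_lt (x : X) (c : R) :
  measurable [set p : P | mdist x (p.1 : X) < alpha * p.2 - c].
Proof.
have m1 : measurable_fun [set: P] (fun p : P => mdist x (p.1 : X)).
  exact: (measurableT_comp (measurable_mdist x) (@measurable_fst _ _ (borel X) (measurableTypeR R))).
have m2 : measurable_fun [set: P] (fun p : P => alpha * p.2 - c).
  apply: measurable_funB => //; apply: measurable_funM => //.
have := measurable_fun_ltr m1 m2 => /(_ measurableT [set true]); rewrite setTI.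
exact.
Qed.

(** An intermediate point [D n] of a dense sequence separates the variables: d(x, y) < alpha t holds
    as soon as [D n] is within 1/(k+1) of x and d(D n, y) < alpha t - 1/(k+1). This writes the set
    as a countable union of products. *)
Lemma measurable_incidence : measurable incidence.
Proof.
have [D HD] := ex_dense_sequence (fun x r r0 => (mu_ball x r0).1).
have -> : incidence = \bigcup_n \bigcup_k (ball (D n) (k.+1%:R^-1 : R) `*`
    [set p : P | mdist (D n) (p.1 : X) < alpha * p.2 - k.+1%:R^-1]).
  apply/seteqP; split=> [[x [y t]] /=|[x [y t]] [n _ [k _ []]]] /=.
    rewrite /incidence/= -subr_gt0 => xyt.
    (* 1/(k+1) is below half of the gap alpha t - d(x, y), because it is spent twice: on d(D n, x)
       and on the subtracted term. *)
    have [k] := ltr_add_invr (divr_gt0 xyt (ltr0Sn _ 1)); rewrite add0r => kk.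
    have [n Dx] := HD x k.+1%:R^-1 (ltac:(by rewrite invr_gt0)).
    exists n => //; exists k => //; split => //=.
    rewrite (le_lt_trans (metric_triangle _ x _))//.
    move: Dx kk; rewrite ballEmdist/=; set c : R := _^-1.
    rewrite ltr_pdivlMr//; lra.
  rewrite ballEmdist/= /incidence/= => Dx Dy.
  rewrite (le_lt_trans (metric_triangle _ (D n) _))// [mdist x _]metric_sym.
  by move: Dx Dy; set c : R := _^-1; lra.
apply: bigcupT_measurable => n; apply: bigcupT_measurable => k.
apply: measurableX; first exact: measurable_mball.
exact: measurable_mdist_lt.
Qed.

Lemma measurable_mu_ball : measurable_fun [set: P] (fun p => VB p).
Proof.
under eq_fun do rewrite -ysection_incidence.
exact: (measurable_fun_ysection mu measurable_incidence).
Qed.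

Lemma mu_ball_fin p : VB p \is a fin_num.
Proof.
have [p0|p0] := ltP 0 (alpha * p.2).
  by rewrite ge0_fin_numE//; exact: (mu_ball _ p0).2.
suff -> : ball (p.1 : X) (alpha * p.2) = set0 by rewrite measure0.
rewrite -subset0 ballEmdist => x /= h.
by have := le_lt_trans (mdist_ge0 _ _) (lt_le_trans h p0); rewrite ltxx.
Qed.

(* The weight 1/V(y, alpha t), equal to 0 outside of the half-space. *)
Definition inv_vol (p : P) : R := (fine (VB p))^-1.

Lemma inv_vol_ge0 p : 0 <= inv_vol p.
Proof. by rewrite invr_ge0 fine_ge0. Qed.

Lemma inv_vol_gt0 p : hs p -> 0 < inv_vol p.
Proof.
move=> p0; have [h1 h2] := mu_ball (p.1 : X) (mulr_gt0 alpha_gt0 p0).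
by rewrite invr_gt0 fine_gt0// h1 h2.
Qed.

Lemma inv_volE p : hs p -> ((inv_vol p)%:E = (VB p)^-1)%E.
Proof.
move=> hp; rewrite -[in RHS](fineK (mu_ball_fin p)) inver.
by have := inv_vol_gt0 hp; rewrite invr_gt0 => /gt_eqF ->.
Qed.

Lemma inv_volK p : hs p -> ((inv_vol p)%:E * VB p = 1)%E.
Proof.
move=> hp; rewrite -(fineK (mu_ball_fin p)) -EFinM mulVf//.
by have := inv_vol_gt0 hp; rewrite invr_gt0 => /gt_eqF ->.
Qed.

Lemma measurable_inv_vol : measurable_fun [set: P] inv_vol.
Proof.
have -> : inv_vol = (@powR R ^~ (-1)) \o (fine \o (fun p => VB p)).
  by apply/funext => p /=; rewrite powR_inv1// fine_ge0.
apply: measurableT_comp; first exact: measurable_powR.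
apply: (measurableT_comp (fine_measurable measurableT)).
exact: measurable_mu_ball.
Qed.

(** The union of cones has arbitrarily many vertices, but cones widen with the height. So it is the
    union over rational s of the open alpha s-neighbourhood of the complement of O times the heights
    above s. *)
Lemma measurable_tent (O : set X) : measurable (tent alpha O).
Proof.
apply: measurableD; first exact: measurable_halfspace.
pose U (s : R) := [set y : X | exists2 x, ~ O x & mdist x y < alpha * s].
have -> : \bigcup_(x in ~` O) cone alpha x =
    \bigcup_(s : rat) ((U (ratr s) : set (borel X)) `*` [set t | ratr s < t]).
  apply/seteqP; split => [[y t] [x Ox [/= t0 xyt]]|[y t] [s _ [/= [x Ox xys st]]]].
    have : mdist x y / alpha < t by rewrite ltr_pdivrMr// mulrC.
    move=> /rat_in_itvoo[s]; rewrite in_itv/= => /andP[s1 s2].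
    exists s => //; split => //=; exists x => //.
    by rewrite mulrC -ltr_pdivrMr.
  have xyt : mdist x y < alpha * t by rewrite (lt_trans xys)// ltr_pM2l.
  by exists x => //; split => //; exact: mdist_lt_halfspace xyt.
apply: bigcupT_measurable_rat => s; apply: measurableX.
  apply: borel_open.
  have -> : U (ratr s) = \bigcup_(x in ~` O) ball x (alpha * ratr s).
    by apply/seteqP; split => [y [x Ox h]|y [x Ox]];
      [exists x|rewrite ballEmdist => h; exists x]; rewrite ?ballEmdist.
  by apply: bigcup_open => x _; exact: open_mball.
rewrite (_ : [set _ | _] = `]ratr s, +oo[%classic)//.
by apply/seteqP; split => t /=; rewrite in_itv/= andbT.
Qed.

End halfspace_geometry.

(** * The area functional *)

Section real_powers.
Context {R : realType}.

(** With v = u^(1/q), either v <= lam, or v^(1-q) <= lam^(1-q) and hence v = v^(1-q) v^q <=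
    lam^(1-q) u. *)
Lemma poweR_root_le (lam q : R) (u : \bar R) : 0 < lam -> 1 < q -> (0 <= u)%E ->
  (u `^ q^-1 <= lam%:E + (lam `^ (1 - q))%:E * u)%E.
Proof.
move=> lam0 q1; have q0 : 0 < q by lra.
have qV0 : 0 < q^-1 by rewrite invr_gt0.
case: u => [u|_|//]; last first.
  by rewrite poweRyr ?gt_eqF// gt0_muley ?lte_fin ?powR_gt0// addey.
rewrite lee_fin => u0; rewrite poweR_EFin -EFinM -EFinD lee_fin.
set v := u `^ q^-1; have v0 : 0 <= v by exact: powR_ge0.
have -> : u = v `^ q by rewrite /v -powRrM mulVf ?gt_eqF// powRr1.
have [vl|lv] := leP v lam; first by rewrite (le_trans vl)// lerDl mulr_ge0// powR_ge0.
apply: (@le_trans _ _ (lam `^ (1 - q) * v `^ q)); last by rewrite lerDr ltW.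
have vp : 0 < v by exact: lt_trans lv.
rewrite -(mulr_powRB1 v0 q0) mulrCA -[leLHS]mulr1 ler_wpM2l//.
rewrite -opprB powRN mulrC ler_pdivlMr ?powR_gt0// mul1r.
by apply: ge0_ler_powR; rewrite ?nnegrE ?ltW// subr_gt0.
Qed.

End real_powers.

Lemma cvg_poweR0 (R : realType) (r : R) (u : nat -> \bar R) : 0 < r ->
  (forall n, 0 <= u n)%E -> (u n @[n --> \oo] --> 0)%E ->
  (u n `^ r @[n --> \oo] --> 0)%E.
Proof.
move=> r0 u0 /fine_cvgP[ufin /cvgr0Pnorm_le u_0].
apply/fine_cvgP; split; first by apply: filterS ufin => n; exact: fin_num_poweR.
apply/cvgr0Pnorm_le => e e0.
have e'0 : 0 < e `^ r^-1 by rewrite powR_gt0.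
apply: filterS (u_0 _ e'0) => n /=.
rewrite fine_poweR ger0_norm ?fine_ge0// ger0_norm ?powR_ge0// => h.
have -> : e = (e `^ r^-1) `^ r by rewrite -powRrM mulVf ?gt_eqF// powRr1// ltW.
by apply: ge0_ler_powR; rewrite ?nnegrE ?powR_ge0 ?fine_ge0// ltW.
Qed.

Section tent_functional.
Context {R : realType} {X : pmetricType R}
  (mu : {sigma_finite_measure set (borel X) -> \bar R}) (alpha : R).
Hypothesis mu_ball : forall (x : X) (r : R), 0 < r ->
  (0 < mu (ball x r))%E /\ (mu (ball x r) < +oo)%E.
Hypothesis alpha_gt0 : 0 < alpha.

Local Notation P := (borel X * measurableTypeR R)%type.
Local Notation hs := (@halfspace R X).
Local Notation m := (halfspace_measure mu).
Local Notation W := (inv_vol mu alpha).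
Local Notation Om := (@incidence R X alpha).
Implicit Types phi psi : P -> R.

Local Notation mOm := (measurable_incidence alpha mu_ball).
Local Notation mhs := (@measurable_halfspace R X).

Lemma measurable_mul_inv_vol (phi : P -> R) : measurable_fun hs phi ->
  measurable_fun hs (fun p => (phi p * W p)%:E).
Proof.
move=> mphi; apply/measurable_EFinP; apply: measurable_funM => //.
by apply: measurable_funTS; exact: measurable_inv_vol.
Qed.

Lemma incidence_halfspace (x : borel X) (p : P) : Om (x, p) -> hs p.
Proof. exact: mdist_lt_halfspace. Qed.

(** Tonelli's theorem is stated for functions on the whole of P, while phi is controlled on the
    half-space only. Sections of subsets of [Om] lie in the half-space, so extension by zero changes
    nothing. *)
Let section_patch (S : set (borel X * P)) (g : P -> \bar R) x : S `<=` Om ->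
  (\int[m]_(p in xsection S x) g p = \int[m]_(p in xsection S x) (g \_ hs) p)%E.
Proof.
move=> SO; apply: eq_integral => p; rewrite inE => /xsectionP /SO /incidence_halfspace hp.
by rewrite patchE mem_set.
Qed.

Lemma measurable_cone_section (S : set (borel X * P)) phi :
  measurable S -> S `<=` Om -> measurable_fun hs phi ->
  (forall p, hs p -> 0 <= phi p) ->
  measurable_fun [set: borel X]
    (fun x => \int[m]_(p in xsection S x) (phi p * W p)%:E)%E.
Proof.
move=> mS SO mphi phi0; under eq_fun do rewrite section_patch//.
apply: measurable_integral_xsection => //.
  by apply/(measurable_restrictT _ mhs); exact: measurable_mul_inv_vol.
by apply: erestrict_ge0 => p hp; rewrite lee_fin mulr_ge0 ?phi0 ?inv_vol_ge0.
Qed.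

Lemma integral_cone_section (S : set (borel X * P)) phi :
  measurable S -> S `<=` Om -> measurable_fun hs phi ->
  (forall p, hs p -> 0 <= phi p) ->
  (\int[mu]_x \int[m]_(p in xsection S x) (phi p * W p)%:E =
   \int[m]_(p in hs) ((phi p * W p)%:E * mu (ysection S p)))%E.
Proof.
move=> mS SO mphi phi0; under eq_integral do rewrite section_patch//.
rewrite integral_xsection//; last 2 first.
- by apply/(measurable_restrictT _ mhs); exact: measurable_mul_inv_vol.
- by apply: erestrict_ge0 => p hp; rewrite lee_fin mulr_ge0 ?phi0 ?inv_vol_ge0.
rewrite [RHS]integral_mkcond; apply: eq_integral => p _.
by rewrite !patchE; case: ifP => //; rewrite mul0e.
Qed.

Definition cone_integral phi (x : borel X) : \bar R :=
  (\int[m]_(p in xsection Om x) (phi p * W p)%:E)%E.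

Lemma cone_integral_ge0 phi x : (forall p, hs p -> 0 <= phi p) ->
  (0 <= cone_integral phi x)%E.
Proof.
move=> phi0; apply: integral_ge0 => p /xsectionP /incidence_halfspace hp.
by rewrite lee_fin mulr_ge0 ?phi0 ?inv_vol_ge0.
Qed.

Lemma measurable_cone_integral phi : measurable_fun hs phi ->
  (forall p, hs p -> 0 <= phi p) -> measurable_fun [set: borel X] (cone_integral phi).
Proof. by move=> ? ?; apply: measurable_cone_section => //; exact: mOm. Qed.

(* Each point of the half-space is weighted by V(y, alpha t)^{-1} and seen     *)
(* from the vertices x in B(y, alpha t).                                       *)
Lemma integral_cone_integral phi : measurable_fun hs phi ->
  (forall p, hs p -> 0 <= phi p) ->
  (\int[mu]_x cone_integral phi x = \int[m]_(p in hs) (phi p)%:E)%E.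
Proof.
move=> mphi phi0; rewrite integral_cone_section//; last exact: mOm.
apply: eq_integral => p; rewrite inE => hp.
by rewrite ysection_incidence// EFinM -muleA inv_volK// mule1.
Qed.

Lemma xsection_incidence_sub x : xsection Om x `<=` hs.
Proof. by move=> p /xsectionP /incidence_halfspace. Qed.

Lemma measurable_xsection_incidence x : measurable (xsection Om x).
Proof. by apply: measurable_xsection; exact: mOm. Qed.

Lemma measurable_cone_integrand phi x : measurable_fun hs phi ->
  measurable_fun (xsection Om x) (fun p => (phi p * W p)%:E).
Proof.
move=> mphi; apply: measurable_funS (measurable_mul_inv_vol mphi) => //.
  exact: mhs.
exact: xsection_incidence_sub.
Qed.

Lemma le_cone_integral phi psi x : measurable_fun hs phi -> measurable_fun hs psi ->
  (forall p, hs p -> 0 <= phi p) -> (forall p, hs p -> phi p <= psi p) ->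
  (cone_integral phi x <= cone_integral psi x)%E.
Proof.
move=> mphi mpsi phi0 phipsi; apply: ge0_le_integral.
- exact: measurable_xsection_incidence.
- by move=> p /xsection_incidence_sub hp; rewrite lee_fin mulr_ge0 ?phi0 ?inv_vol_ge0.
- exact: measurable_cone_integrand.
- exact: measurable_cone_integrand.
- move=> p /xsection_incidence_sub hp.
  by rewrite lee_fin ler_wpM2r ?phipsi ?inv_vol_ge0.
Qed.

Variable q : R.
Hypothesis q_gt1 : 1 < q.
Let q_gt0 : 0 < q. Proof. exact: lt_trans ltr01 q_gt1. Qed.
Let qV_gt0 : 0 < q^-1. Proof. by rewrite invr_gt0. Qed.

(* The T^{1,q}-norm of f, as a function of phi = |f|^q. *)
Definition tent1 phi : \bar R := (\int[mu]_x (cone_integral phi x `^ q^-1))%E.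

Lemma measurable_root_cone_integral phi : measurable_fun hs phi ->
  (forall p, hs p -> 0 <= phi p) ->
  measurable_fun [set: borel X] (fun x => cone_integral phi x `^ q^-1)%E.
Proof.
move=> mphi phi0; apply: (measurableT_comp (measurable_poweR _)).
exact: measurable_cone_integral.
Qed.

Lemma le_tent1 phi psi : measurable_fun hs phi -> measurable_fun hs psi ->
  (forall p, hs p -> 0 <= phi p) -> (forall p, hs p -> phi p <= psi p) ->
  (tent1 phi <= tent1 psi)%E.
Proof.
move=> mphi mpsi phi0 phipsi.
have psi0 p : hs p -> 0 <= psi p by move=> hp; rewrite (le_trans (phi0 _ hp))// phipsi.
apply: ge0_le_integral => //.
- by move=> x _; exact: poweR_ge0.
- exact: measurable_root_cone_integral.
- exact: measurable_root_cone_integral.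
- move=> x _; apply: (gt0_ler_poweR (ltW qV_gt0)).
  + by rewrite in_itv/= leey cone_integral_ge0.
  + by rewrite in_itv/= leey cone_integral_ge0.
  + exact: (le_cone_integral _ mphi mpsi phi0 phipsi).
Qed.

(** phi stands for |f|^q: multiplying f by c multiplies phi by c^q. *)
Lemma tent1_scale (c : R) phi : 0 <= c -> measurable_fun hs phi ->
  (forall p, hs p -> 0 <= phi p) ->
  (tent1 (fun p => (c `^ q) * phi p)%R = c%:E * tent1 phi)%E.
Proof.
move=> c0 mphi phi0; rewrite /tent1 -ge0_integralZl//; last 2 first.
- exact: measurable_root_cone_integral.
- by move=> x _; exact: poweR_ge0.
apply: eq_integral => x _.
have -> : cone_integral (fun p => (c `^ q) * phi p)%R x =
    ((c `^ q)%:E * cone_integral phi x)%E.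
  rewrite /cone_integral -(ge0_integralZl _ (measurable_xsection_incidence x)
    (measurable_cone_integrand mphi (x:=x))); first 1 last.
  - by move=> p /xsection_incidence_sub hp; rewrite lee_fin mulr_ge0 ?phi0 ?inv_vol_ge0.
  - by rewrite lee_fin powR_ge0.
  by apply: eq_integral => p _; rewrite -EFinM mulrA.
rewrite poweRM ?lee_fin ?powR_ge0 ?cone_integral_ge0//.
by rewrite poweR_EFin -powRrM mulfV ?gt_eqF// powRr1.
Qed.

(* Homogenised Hoelder inequality; [lam] is left to be optimised. *)
Lemma tent1_local (lam : R) (F : set (borel X)) phi : 0 < lam ->
  measurable F -> measurable_fun hs phi -> (forall p, hs p -> 0 <= phi p) ->
  (forall x p, ~ F x -> Om (x, p) -> phi p = 0) ->
  (tent1 phi <= lam%:E * mu F + (lam `^ (1 - q))%:E * \int[m]_(p in hs) (phi p)%:E)%E.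
Proof.
move=> lam0 mF mphi phi0 phiF.
have mC := measurable_cone_integral mphi phi0.
have -> : (lam%:E * mu F = \int[mu]_x (lam * \1_F x)%:E)%E.
  under eq_integral do rewrite EFinM.
  rewrite ge0_integralZl//; first by rewrite integral_indic// setIT.
    by apply/measurable_EFinP; exact: measurable_indic.
  by rewrite lee_fin ltW.
rewrite -integral_cone_integral// -ge0_integralZl//; last 2 first.
- by move=> x _; exact: cone_integral_ge0.
- by rewrite lee_fin powR_ge0.
rewrite -ge0_integralD//; last 4 first.
- by move=> x _; rewrite lee_fin mulr_ge0// ltW.
- by apply/measurable_EFinP; apply: measurable_funM => //; exact: measurable_indic.
- by move=> x _; rewrite mule_ge0 ?lee_fin ?powR_ge0 ?cone_integral_ge0.
- exact: measurable_funeM.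
apply: ge0_le_integral => //.
- by move=> x _; exact: poweR_ge0.
- exact: measurable_root_cone_integral.
- apply: emeasurable_funD; last exact: measurable_funeM.
  by apply/measurable_EFinP; apply: measurable_funM => //; exact: measurable_indic.
- move=> x _; have [Fx|nFx] := pselect (F x).
    by rewrite indicE mem_set// mulr1 poweR_root_le// cone_integral_ge0.
  (* A vertex outside F sees no point where phi is nonzero, so lam is paid on F only. *)
  have -> : cone_integral phi x = 0%E.
    apply: integral0_eq => p /xsectionP xp.
    by rewrite (phiF x)// mul0r.
  by rewrite poweR0r ?gt_eqF// mule0 adde0 lee_fin mulr_ge0// ltW.
Qed.

(** Dominated convergence is used twice: on the cone at almost every x, where finiteness of the norm
    makes the integral of phi finite, and then over x with the area function of phi as majorant. *)
Lemma dominated_tent1 (phi_ : nat -> P -> R) phi :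
  (forall n, measurable_fun hs (phi_ n)) -> measurable_fun hs phi ->
  (forall n p, hs p -> 0 <= phi_ n p <= phi p) ->
  (forall p, hs p -> phi_ n p @[n --> \oo] --> 0) ->
  (tent1 phi < +oo)%E -> (tent1 (phi_ n) @[n --> \oo] --> 0)%E.
Proof.
move=> mphi_ mphi bphi cphi fin.
have phi_0 n p : hs p -> 0 <= phi_ n p by move=> /(bphi n) /andP[].
have phi0 p : hs p -> 0 <= phi p.
  by move=> hp; have /andP[/le_trans h /h] := bphi 0%N p hp.
have mA := measurable_root_cone_integral mphi phi0.
have iA : mu.-integrable setT (fun x => cone_integral phi x `^ q^-1)%E.
  apply/integrableP; split => //.
  by under eq_integral do rewrite gee0_abs ?poweR_ge0//.
have cvA : {ae mu, forall x, [set: borel X] x ->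
    (cone_integral (phi_ n) x `^ q^-1 @[n --> \oo] --> 0)%E}.
  have := integrable_ae measurableT iA; apply: filterS => x /(_ Logic.I) xfin _.
  have Cfin : (cone_integral phi x < +oo)%E.
    move: xfin; rewrite ge0_fin_numE ?poweR_ge0// => /lty_poweRy.
    by apply; rewrite gt_eqF.
  have iC : m.-integrable (xsection Om x) (fun p => (phi p * W p)%:E).
    apply/integrableP; split; first exact: measurable_cone_integrand.
    rewrite (eq_integral (fun p => (phi p * W p)%:E))// => p.
    rewrite inE => /xsection_incidence_sub hp.
    by rewrite gee0_abs// lee_fin mulr_ge0 ?phi0 ?inv_vol_ge0.
  apply: cvg_poweR0 => //; first by move=> n; exact: cone_integral_ge0 (phi_0 n).
  have cvp : {ae m, forall p, xsection Om x p ->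
      ((phi_ n p * W p)%:E @[n --> \oo] --> 0)%E}.
    apply: aeW => p /xsection_incidence_sub hp.
    rewrite -[0%E]/((0:R)%:E) -(mul0r (W p)).
    apply: cvg_EFin; first exact: nearW.
    by apply: cvgM; [exact: cphi|exact: cvg_cst].
  have := @dominated_convergence _ _ _ m _ (measurable_xsection_incidence x)
    (fun n p => (phi_ n p * W p)%:E) (cst 0%E) _
    (fun n => measurable_cone_integrand (x:=x) (mphi_ n)) (measurable_cst _) cvp iC.
  rewrite integral0 => -[|_ _]; last exact.
  apply: aeW => p n /xsection_incidence_sub hp.
  have /andP[h1 h2] := bphi n p hp.
  by rewrite gee0_abs lee_fin ?ler_wpM2r ?mulr_ge0 ?inv_vol_ge0.
have := @dominated_convergence _ _ _ mu setT measurableT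
  (fun n x => cone_integral (phi_ n) x `^ q^-1)%E (cst 0%E)
  (fun x => cone_integral phi x `^ q^-1)%E
  (fun n => measurable_root_cone_integral (mphi_ n) (phi_0 n))
  (measurable_cst _) cvA iA.
rewrite integral0 => -[|_ _]; last exact.
apply: aeW => x n _; rewrite gee0_abs ?poweR_ge0//.
apply: (gt0_ler_poweR (ltW qV_gt0)).
- by rewrite in_itv/= leey andbT; exact: cone_integral_ge0 (phi_0 n).
- by rewrite in_itv/= leey cone_integral_ge0.
- apply: le_cone_integral => //; first exact: phi_0.
  by move=> p hp; have /andP[] := bphi n p hp.
Qed.

End tent_functional.

(** * The duality inequality *)

(** The weight splits as w = w^(1/p) w^(1/q), and the functions are extended by zero off D to meet
    the unweighted inequality on the whole space. *)
Lemma weighted_hoelder d (T : measurableType d) (R : realType)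
    (mu : {measure set T -> \bar R}) (D : set T) (a b w : T -> R) (p q : R) :
  measurable D -> measurable_fun D a -> measurable_fun D b -> measurable_fun D w ->
  (forall x, D x -> 0 <= a x) -> (forall x, D x -> 0 <= b x) ->
  (forall x, D x -> 0 <= w x) -> 0 < p -> 0 < q -> p^-1 + q^-1 = 1 ->
  (\int[mu]_(x in D) (a x * b x * w x)%:E <=
   (\int[mu]_(x in D) ((a x `^ p) * w x)%:E) `^ p^-1 *
   (\int[mu]_(x in D) ((b x `^ q) * w x)%:E) `^ q^-1)%E.
Proof.
move=> mD ma mb mw a0 b0 w0 p0 q0 pq.
pose F (c : T -> R) r := (fun x => c x * w x `^ r^-1) \_ D.
have mF c r : measurable_fun D c -> measurable_fun setT (F c r).
  move=> mc; apply/(measurable_restrictT _ mD); apply: measurable_funM => //.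
  by apply: (measurableT_comp (measurable_powR _)).
have normF c r : 0 < r -> (forall x, D x -> 0 <= c x) ->
    ('N[mu]_r%:E[EFin \o F c r] =
     (\int[mu]_(x in D) ((c x `^ r) * w x)%:E) `^ r^-1)%E.
  move=> r0 c0; rewrite unlock; congr poweR.
  rewrite [RHS]integral_mkcond; apply: eq_integral => x _ /=.
  rewrite /F !patchE; case: ifPn => [|_]; last first.
    by rewrite normr0 powR0// gt_eqF.
  rewrite inE => Dx; have cw0 : 0 <= c x * w x `^ r^-1 by rewrite mulr_ge0 ?c0 ?powR_ge0.
  rewrite ger0_norm// powRM ?c0 ?powR_ge0// -powRrM mulVf ?gt_eqF// powRr1//.
  exact: w0.
have := hoelder mu (mF a p ma) (mF b q mb) p0 q0 pq.
rewrite !normF//; apply: le_trans.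
rewrite Lnorm1 integral_mkcond le_eqVlt; apply/orP; left; apply/eqP.
apply: eq_integral => x _ /=; rewrite /F !patchE.
case: ifPn => [|_]; last by rewrite mulr0 normr0.
rewrite inE => Dx.
have -> : a x * w x `^ p^-1 * (b x * w x `^ q^-1) = a x * b x * w x.
  rewrite mulrACA -powRD ?pq ?powRr1 ?w0// oner_eq0//.
by rewrite ger0_norm// !mulr_ge0 ?a0 ?b0 ?w0.
Qed.

Section tent_duality_bound.
Context {R : realType} {X : pmetricType R}
  (mu : {sigma_finite_measure set (borel X) -> \bar R}) (alpha : R).
Hypothesis mu_ball : forall (x : X) (r : R), 0 < r ->
  (0 < mu (ball x r))%E /\ (mu (ball x r) < +oo)%E.
Hypothesis alpha_gt0 : 0 < alpha.

Local Notation P := (borel X * measurableTypeR R)%type.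
Local Notation hs := (@halfspace R X).
Local Notation m := (halfspace_measure mu).
Local Notation W := (inv_vol mu alpha).
Local Notation Om := (@incidence R X alpha).
Local Notation mOm := (measurable_incidence alpha mu_ball).
Local Notation mhs := (@measurable_halfspace R X).

Variables (C : R) (q q' : R) (G : R) (u gam : P -> R).
Hypothesis C_gt0 : 0 < C.
Hypothesis mu_doubling : forall (x : X) (r : R), 0 < r ->
  (mu (ball x (2 * r)) <= C%:E * mu (ball x r))%E.
Hypotheses (q_gt0 : 0 < q) (q'_gt0 : 0 < q') (qq' : q^-1 + q'^-1 = 1).
Hypothesis G_gt0 : 0 < G.
Hypotheses (mu_ : measurable_fun hs u) (mgam : measurable_fun hs gam).
Hypotheses (u_ge0 : forall p, hs p -> 0 <= u p)
  (gam_ge0 : forall p, hs p -> 0 <= gam p).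
Hypothesis gam_tent : forall (y : X) (r : R), 0 < r ->
  (\int[m]_(p in tent alpha (ball y r)) (gam p `^ q')%:E <=
     (G `^ q')%:E * mu (ball y r))%E.

Let phi (p : P) := gam p `^ q'.
Let phi_ge0 p : hs p -> 0 <= phi p. Proof. by move=> _; exact: powR_ge0. Qed.
Let mphi : measurable_fun hs phi.
Proof. exact: (measurableT_comp (measurable_powR _)). Qed.

Let trunc : set ((borel X * measurableTypeR R) * P) :=
  [set z | Om (z.1.1, z.2) /\ z.2.2 < z.1.2].

Let measurable_trunc : measurable trunc.
Proof.
rewrite /trunc (_ : [set _ | _] =
  ((fun z : (borel X * measurableTypeR R) * P => (z.1.1, z.2)) @^-1` Om) `&`
  [set z | z.2.2 < z.1.2]) //.
have f11 : measurable_fun setT (fun z : (borel X * measurableTypeR R) * P => z.1.1).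
  exact: (measurableT_comp measurable_fst measurable_fst).
have f12 : measurable_fun setT (fun z : (borel X * measurableTypeR R) * P => z.1.2).
  exact: (measurableT_comp measurable_snd measurable_fst).
have f22 : measurable_fun setT (fun z : (borel X * measurableTypeR R) * P => z.2.2).
  exact: (measurableT_comp measurable_snd measurable_snd).
apply: measurableI.
  rewrite -[X in measurable X]setTI.
  by apply: measurable_fun_pair => //; exact: mOm.
have := measurable_fun_ltr f22 f12 => /(_ measurableT [set true]); rewrite setTI.
exact.
Qed.

(* The q'-th power of the area function truncated at height t, at z = (x, t). *)
Let area (z : borel X * measurableTypeR R) : \bar R :=
  (\int[m]_(p in xsection trunc z) (phi p * W p)%:E)%E.

Let trunc_hs z : xsection trunc z `<=` hs.
Proof. by move=> p /xsectionP[/(incidence_halfspace alpha_gt0)]. Qed.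

Let area_patch z : area z =
  (\int[m]_(p in xsection trunc z) ((fun p => (phi p * W p)%:E) \_ hs) p)%E.
Proof.
by apply: eq_integral => p; rewrite inE => /trunc_hs hp; rewrite patchE mem_set.
Qed.

Let patch_ge0 p : (0 <= ((fun p => (phi p * W p)%:E) \_ hs) p)%E.
Proof.
by apply: erestrict_ge0 => {}p hp; rewrite lee_fin mulr_ge0 ?phi_ge0 ?inv_vol_ge0.
Qed.

Let measurable_area : measurable_fun setT area.
Proof.
have -> : area = (fun z => \int[m]_(p in xsection trunc z)
    ((fun p => (phi p * W p)%:E) \_ hs) p)%E by apply/funext => z; exact: area_patch.
apply: measurable_integral_xsection => //.
by apply/(measurable_restrictT _ mhs); exact: measurable_mul_inv_vol.
Qed.

Let area_ge0 z : (0 <= area z)%E.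
Proof. by rewrite area_patch; apply: integral_ge0 => p _. Qed.

(** Twice the mean value of [area] allowed by [integral_area], so that Chebyshev's inequality loses
    at most half of each ball. *)
Let level : R := 2 * C ^+ 3 * G `^ q'.
Let level_gt0 : 0 < level.
Proof. by rewrite /level !mulr_gt0 ?exprn_gt0 ?powR_gt0. Qed.

(** Pairs of a point p and a good vertex for it. The doubled height is used in [integral_good]. *)
Let good : set (borel X * P) := [set z | Om z /\ (area (z.1, (2 * z.2.2)%R) <= level%:E)%E].

Let measurable_good : measurable good.
Proof.
have mh : measurable_fun [set: borel X * P]
    (fun z : borel X * P => area (z.1, 2 * z.2.2 : measurableTypeR R)).
  apply: (measurableT_comp measurable_area); apply: measurable_fun_pair => //.
  by apply: measurable_funM => //; exact: (measurableT_comp measurable_snd measurable_snd).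
rewrite /good (_ : [set _ | _] = Om `&` [set z | (area (z.1, (2 * z.2.2)%R) <= level%:E)%E])//.
apply: measurableI; first exact: mOm.
by rewrite -[X in measurable X]setTI; exact: emeasurable_fun_infty_c.
Qed.

(* The truncated cones with vertex in B(y, alpha t) lie over a fixed dilate of *)
(* the ball, so the average of [area] is controlled by the Carleson condition. *)
Let integral_area (p : P) : hs p ->
  (\int[mu]_(x in ball (p.1 : X) (alpha * p.2)) area (x, (2 * p.2)%R) <=
     (C ^+ 3 * G `^ q')%:E * mu (ball (p.1 : X) (alpha * p.2)))%E.
Proof.
case: p => y t /= hp; have t0 : 0 < t := hp.
have at0 : 0 < alpha * t by rewrite mulr_gt0.
set B := ball (y : X) (alpha * t).
have mB : measurable (B : set (borel X)) by exact: measurable_mball.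
pose S : set (borel X * P) := [set z | Om z /\ (B z.1 /\ z.2.2 < 2 * t)].
have mS : measurable S.
  rewrite /S (_ : [set _ | _] = Om `&` (B `*` (setT `*` `]-oo, 2 * t[%classic))).
    apply: measurableI; first exact: mOm.
    by apply: measurableX => //; exact: measurableX.
  by apply/seteqP; split => [[x [z s]] /= [? []]|[x [z s]] /= [? [? []]]];
    rewrite ?in_itv.
have SO : S `<=` Om by move=> z [].
have -> : (\int[mu]_(x in B) area (x, (2 * t)%R) =
    \int[mu]_x \int[m]_(p in xsection S x) (phi p * W p)%:E)%E.
  rewrite integral_mkcond; apply: eq_integral => x _; rewrite patchE.
  case: ifPn => [|/negP]; rewrite inE => Bx.
    rewrite /area; congr (integral _ _ _); apply/seteqP.
    by split => p /xsectionP h; apply/xsectionP; move: h; rewrite /trunc /S /=; tauto.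
  by rewrite (_ : xsection S x = set0) ?integral_set0//;
    apply/seteqP; split => // p /xsectionP[_ []].
rewrite integral_cone_section//.
(* If d(y, x) < alpha t and a point of height below 2t lies in the cones at x and at z, then d(y, z)
   < (1 + 2 + 2) alpha t. The radius is rounded up to 8 alpha t, which costs three doublings. *)
have B8 : (mu (ball (y : X) (8 * (alpha * t))) <= (C ^+ 3)%:E * mu B)%E.
  have -> : 8 * (alpha * t) = 2 * (2 * (2 * (alpha * t))) by lra.
  have h3 := mu_doubling y at0.
  have h2 : 0 < 2 * (alpha * t) by rewrite mulr_gt0.
  have h1 : 0 < 2 * (2 * (alpha * t)) by rewrite mulr_gt0.
  apply: (le_trans (mu_doubling y h1)); rewrite !exprS expr0 mulr1 !EFinM -!muleA.
  have C0 : (0 <= C%:E)%E by rewrite lee_fin ltW.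
  apply: lee_wpmul2l => //; apply: (le_trans (mu_doubling y h2)).
  exact: lee_wpmul2l.
apply: (@le_trans _ _ (\int[m]_(p in tent alpha (ball (y : X) (8 * (alpha * t)))) (phi p)%:E)%E).
  rewrite integral_mkcond [leRHS]integral_mkcond.
  have mT := measurable_tent alpha_gt0 (ball (y : X) (8 * (alpha * t))).
  apply: ge0_le_integral => //.
  - move=> p _; apply: erestrict_ge0 => {}p hp'.
    by rewrite mule_ge0// lee_fin mulr_ge0 ?phi_ge0 ?inv_vol_ge0.
  - apply/(measurable_restrictT _ mhs); apply: emeasurable_funM.
      exact: measurable_mul_inv_vol.
    by apply: measurable_funTS; exact: (measurable_fun_ysection mu mS).
  - apply/(measurable_restrictT _ mT); apply/measurable_EFinP.
    by apply: measurable_funS mphi => //; [exact: mhs|by move=> p []].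
  move=> p _; rewrite !patchE; case: ifPn => [|_]; last first.
    by case: ifPn => // _; rewrite lee_fin powR_ge0.
  (* In the tent, the section of S lies in the ball at p, so its measure times [W p] is at most 1.
     Outside the tent the section is empty. *)
  rewrite inE => hp'; case: ifPn => [_|/negP nT].
    rewrite EFinM -muleA -[leRHS]mule1; apply: lee_wpmul2l.
      by rewrite lee_fin phi_ge0.
    rewrite -(inv_volK mu_ball alpha_gt0 hp'); apply: lee_wpmul2l.
      by rewrite lee_fin inv_vol_ge0.
    rewrite -ysection_incidence//; apply: le_measure; rewrite ?inE.
    + exact: measurable_ysection.
    + by apply: measurable_ysection; exact: mOm.
    + by move=> x /ysectionP[? _]; apply/ysectionP.
  suff -> : ysection S p = set0 by rewrite measure0 mule0.
  rewrite -subset0 => x /ysectionP[/= xp [Bx pt]]; apply: nT; rewrite inE.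
  split => // -[z]; rewrite ballEmdist => /negP; rewrite -leNgt => yz [_ zp].
  move: Bx; rewrite /B ballEmdist /= => yx.
  have := metric_triangle (y : X) (x : X) (p.1 : X).
  have := metric_triangle (y : X) (p.1 : X) (z : X).
  rewrite [mdist (p.1 : X) z]metric_sym; move: xp; rewrite /incidence /= => xp.
  have : alpha * p.2 < 2 * (alpha * t) by rewrite mulrCA ltr_pM2l.
  lra.
apply: (le_trans (gam_tent y _)); first by rewrite mulr_gt0.
rewrite [C ^+ 3 * _]mulrC EFinM -muleA; apply: lee_wpmul2l => //.
by rewrite lee_fin powR_ge0.
Qed.

(** On the bad part of the ball [area] exceeds [level], while its integral over the whole ball is at
    most (level / 2) times the measure of the ball; hence the bad part is at most half. *)
Let mu_good (p : P) : hs p ->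
  (mu (ball (p.1 : X) (alpha * p.2)) <= 2%:E * mu (ysection good p))%E.
Proof.
move=> hp; set B := ball _ _.
have at0 : 0 < alpha * p.2 by rewrite mulr_gt0.
have mB : measurable (B : set (borel X)) by exact: measurable_mball.
have Bfin : mu B \is a fin_num := mu_ball_fin alpha mu_ball p.
have mgood : measurable (ysection good p) by exact: measurable_ysection.
have goodB : ysection good p `<=` B.
  by move=> x /ysectionP[xp _]; rewrite /B -ysection_incidence; apply/ysectionP.
pose bad := B `\` ysection good p.
have mbad : measurable (bad : set (borel X)) by exact: measurableD.
have goodfin : mu (ysection good p) \is a fin_num.
  by rewrite ge0_fin_numE// (le_lt_trans _ (mu_ball (p.1 : X) at0).2)// le_measure ?inE.
have badfin : mu bad \is a fin_num.
  rewrite ge0_fin_numE// (le_lt_trans _ (mu_ball (p.1 : X) at0).2)// le_measure ?inE//.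
  by move=> x [].
have Bsplit : (mu B = mu (ysection good p) + mu bad)%E.
  by rewrite -measureU// /bad ?setDIK// setDUK.
have marea : measurable_fun [set: borel X] (fun x => area (x, (2 * p.2)%R)).
  by apply: (measurableT_comp measurable_area); exact: pair2_measurable.
have bad_le : (level%:E * mu bad <= (level / 2)%:E * mu B)%E.
  have -> : level / 2 = C ^+ 3 * G `^ q' by rewrite /level; field.
  apply: le_trans (integral_area hp).
  rewrite -integral_cst//.
  apply: (@le_trans _ _ (\int[mu]_(x in bad) area (x, (2 * p.2)%R))%E).
    apply: ge0_le_integral => //.
    - by move=> x _; rewrite lee_fin ltW.
    - exact: measurable_funTS.
    - move=> x [Bx /ysectionP nx]; rewrite leNgt; apply/negP => /ltW h.
      apply: nx; split => //.
      by move: Bx; rewrite /B -ysection_incidence => /ysectionP.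
  apply: ge0_subset_integral => //.
  - exact: measurable_funTS.
  - by move=> x [].
move: bad_le; rewrite Bsplit -(fineK goodfin) -(fineK badfin) -EFinD -!EFinM !lee_fin.
set g := fine (mu (ysection good p)); set b := fine (mu bad) => h.
have {}h : level * b <= level * ((g + b) / 2).
  by move: h; lra.
move: h; rewrite (ler_pM2l level_gt0) => h.
by lra.
Qed.

Let measurable_xgood x : measurable (xsection good x).
Proof. exact: measurable_xsection. Qed.

Let xgood_sub x : xsection good x `<=` xsection Om x.
Proof. by move=> p /xsectionP[? _]; apply/xsectionP. Qed.

Let measurable_phiW x (D : set P) : measurable D -> D `<=` xsection Om x ->
  measurable_fun D (fun p => (phi p * W p)%:E).
Proof.
move=> mD DO; apply: (measurable_funS _ DO).
  by apply: measurable_xsection; exact: mOm.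
exact: measurable_cone_integrand.
Qed.

Let phiW_ge0 (p : P) : hs p -> (0 <= (phi p * W p)%:E)%E.
Proof. by move=> hp; rewrite lee_fin mulr_ge0 ?phi_ge0 ?inv_vol_ge0. Qed.

(* [area] increases with the height, so the good heights over x form an        *)
(* interval, and half of its supremum still is a good height.                  *)
Let integral_good (x : borel X) :
  (\int[m]_(p in xsection good x) (phi p * W p)%:E <= level%:E)%E.
Proof.
pose I := [set t : R | 0 < t /\ (area (x, (2 * t)%R) <= level%:E)%E].
have le_area (D : set P) t : measurable D -> I t -> D `<=` xsection Om x ->
    (forall p, D p -> p.2 < 2 * t) ->
    (\int[m]_(p in D) (phi p * W p)%:E <= level%:E)%E.
  move=> mD [_ It] DO Dt; apply: le_trans It; apply: ge0_subset_integral => //.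
  - exact: measurable_xsection.
  - apply: measurable_phiW (x) _ _ _; first exact: measurable_xsection.
    by move=> p /xsectionP[? _]; apply/xsectionP.
  - by move=> p /trunc_hs /phiW_ge0.
  - by move=> p Dp; apply/xsectionP; split; [exact/xsectionP/DO|exact: Dt].
have goodI p : xsection good x p -> I p.2.
  by move=> /xsectionP[xp h]; split => //; exact: incidence_halfspace xp.
have [->|/set0P[p0 gp0]] := eqVneq (xsection good x) set0.
  by rewrite integral_set0 lee_fin ltW.
have I0 : I !=set0 by exists p0.2; exact: goodI.
have [ubI|nubI] := pselect (has_ubound I).
  have supI : has_sup I by [].
  have s0 : 0 < sup I by apply: (lt_le_trans (goodI _ gp0).1); exact/ub_le_sup/goodI.
  (* A good height t above half of the supremum: all good points over x have height at most sup I <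
     2t, so the single estimate at t covers them. *)
  have [t It st] := sup_adherent (divr_gt0 s0 (ltr0Sn _ 1)) supI.
  apply: (le_area _ t) => // p gp.
  have : p.2 <= sup I by apply: ub_le_sup => //; exact: goodI.
  by lra.
(* With unbounded good heights, the part below height n is covered by a good height above n, and
   monotone convergence lets n grow. *)
pose D n := xsection good x `&` [set p | p.2 < n%:R].
have mD n : measurable (D n).
  apply: measurableI => //; rewrite (_ : [set _ | _] = setT `*` `]-oo, n%:R[%classic).
    exact: measurableX.
  by apply/seteqP; split => [[y t]|[y t] []] /=; rewrite in_itv.
have DO n : D n `<=` xsection Om x by move=> p [/xgood_sub].
have -> : xsection good x = \bigcup_n D n.
  apply/seteqP; split => [p gp|p [n _ []]//].
  exists (Num.truncn p.2).+1 => //; split => //=; exact: truncnS_gt.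
have ndD : nondecreasing_seq D.
  move=> i j ij; rewrite subsetEset => p [gp pi]; split => //=.
  by rewrite (lt_le_trans pi)// ler_nat.
have /cvg_lim <- // := @ge0_nondecreasing_set_cvg_integral _ _ _ D
  (fun p => (phi p * W p)%:E) m ndD mD (fun i => measurable_phiW (mD i) (@DO i))
  (fun i p Dp => phiW_ge0 (xsection_incidence_sub alpha_gt0 (DO i p Dp))).
apply: lime_le.
  apply: ereal_nondecreasing_is_cvgn; apply: ge0_nondecreasing_set_nondecreasing_integral => //.
  - by move=> i; exact: measurable_phiW (DO i).
  - by move=> i p /DO /(xsection_incidence_sub alpha_gt0) /phiW_ge0.
apply: nearW => n.
have [t It nt] : exists2 t, I t & n%:R < t.
  apply: contrapT => abs; apply: nubI; exists n%:R => t It.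
  by rewrite leNgt; apply/negP => nt; apply: abs; exists t.
apply: (le_area _ t) => // p [_ /= pn].
have := It.1; lra.
Qed.

(** The factor 2 pays for keeping good vertices only; the rest of the constant is [level] to the
    power 1/q', the bound on the factor of |g| in Hoelder's inequality over the good part of a
    cone. *)
Lemma tent_duality_le :
  (\int[m]_(p in hs) (u p * gam p)%:E <=
    (2 * (2 * C ^+ 3) `^ q'^-1 * G)%:E * tent1 mu alpha q (fun p => u p `^ q)%R)%E.
Proof.
have mug : measurable_fun hs (fun p => u p * gam p) by exact: measurable_funM.
have ug0 p : hs p -> 0 <= u p * gam p by move=> hp; rewrite mulr_ge0 ?u_ge0 ?gam_ge0.
have muq : measurable_fun hs (fun p => u p `^ q).
  exact: (measurableT_comp (measurable_powR _)).
have uq0 (p : P) : hs p -> 0 <= u p `^ q by move=> _; exact: powR_ge0.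
have goodO : good `<=` Om by move=> z [].
apply: (@le_trans _ _ (2%:E * \int[mu]_x \int[m]_(p in xsection good x)
    ((u p * gam p) * W p)%:E)%E).
  rewrite integral_cone_section//.
  have mg : measurable_fun hs (fun p => ((u p * gam p) * W p)%:E * mu (ysection good p))%E.
    apply: emeasurable_funM; first exact: measurable_mul_inv_vol.
    by apply: measurable_funTS; exact: (measurable_fun_ysection mu measurable_good).
  have g0 p : hs p -> (0 <= ((u p * gam p) * W p)%:E * mu (ysection good p))%E.
    by move=> hp; rewrite mule_ge0// lee_fin mulr_ge0 ?ug0 ?inv_vol_ge0.
  rewrite -ge0_integralZl//; last exact: mhs.
  apply: ge0_le_integral => //; first exact: mhs.
  - exact/measurable_EFinP.
  - exact: measurable_funeM.
  move=> p hp; rewrite [in leRHS]EFinM [leRHS]muleCA -[leRHS]muleA -[leLHS]mule1.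
  apply: lee_wpmul2l; first by rewrite lee_fin ug0.
  rewrite -(inv_volK mu_ball alpha_gt0 hp); apply: lee_wpmul2l.
    by rewrite lee_fin inv_vol_ge0.
  exact: mu_good.
rewrite -!mulrA EFinM -muleA; apply: lee_wpmul2l => //.
have levelE : (level%:E `^ q'^-1 = ((2 * C ^+ 3) `^ q'^-1 * G)%:E)%E.
  rewrite poweR_EFin /level powRM ?powR_ge0 ?mulr_ge0 ?exprn_ge0 ?ltW//.
  by rewrite -powRrM mulfV ?gt_eqF// powRr1 ?ltW.
have mcone := measurable_root_cone_integral mu_ball alpha_gt0 q muq uq0.
rewrite -levelE /tent1 -ge0_integralZl//; last 2 first.
- by move=> x _; exact: poweR_ge0.
- exact: poweR_ge0.
apply: ge0_le_integral => //.
- move=> x _; apply: integral_ge0 => p /xgood_sub /(xsection_incidence_sub alpha_gt0) hp.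
  by rewrite lee_fin mulr_ge0 ?ug0 ?inv_vol_ge0.
- exact: measurable_cone_section.
- exact: measurable_funeM.
move=> x _.
have gs : xsection good x `<=` hs.
  by move=> p /xgood_sub /(xsection_incidence_sub alpha_gt0).
have mW : measurable_fun hs W by apply: measurable_funTS; exact: measurable_inv_vol.
apply: (le_trans (weighted_hoelder _ (measurable_xgood x)
  (measurable_funS mhs gs mu_) (measurable_funS mhs gs mgam)
  (measurable_funS mhs gs mW) _ _ _ q_gt0 q'_gt0 qq')).
- by move=> p /gs; exact: u_ge0.
- by move=> p /gs; exact: gam_ge0.
- by move=> p _; exact: inv_vol_ge0.
rewrite muleC; apply: lee_pmul.
- exact: poweR_ge0.
- exact: poweR_ge0.
- apply: gt0_ler_poweR.
  + by rewrite invr_ge0 ltW.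
  + by rewrite in_itv/= leey andbT integral_ge0// => p /gs hp; exact: phiW_ge0.
  + by rewrite in_itv/= leey andbT lee_fin ltW.
  + exact: integral_good.
- apply: gt0_ler_poweR.
  + by rewrite invr_ge0 ltW.
  + rewrite in_itv/= leey andbT integral_ge0// => p /gs hp.
    by rewrite lee_fin mulr_ge0 ?powR_ge0 ?inv_vol_ge0.
  + by rewrite in_itv/= leey andbT cone_integral_ge0.
  + apply: ge0_subset_integral => //.
    * by apply: measurable_xsection; exact: mOm.
    * exact: measurable_cone_integrand.
    * by move=> p _; rewrite lee_fin mulr_ge0 ?powR_ge0 ?inv_vol_ge0.
Qed.

End tent_duality_bound.

(** * Functionals on bounded functions and their densities *)

Section bounded_functionals.
Context d (T : measurableType d) (R : realType).
Implicit Types (D A : set T) (f g : T -> R).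

(** The bound by a multiple of the indicator also makes f vanish off D, so f is a function on all of
    T. *)
Definition bounded_on D f :=
  measurable_fun setT f /\ exists M, forall x, `|f x| <= M * \1_D x.

Lemma bounded_on_lin D (a : R) f g : bounded_on D f -> bounded_on D g ->
  bounded_on D (fun x => a * f x + g x).
Proof.
move=> [mf [M fM]] [mg [N gN]]; split.
  by apply: measurable_funD => //; exact: measurable_funM.
exists (`|a| * M + N) => x; rewrite (le_trans (ler_normD _ _))// mulrDl lerD//.
by rewrite normrM -mulrA ler_wpM2l.
Qed.

Lemma bounded_on_indic D A : measurable D -> measurable A ->
  bounded_on D (\1_(A `&` D)).
Proof.
move=> mD mA; split; first by apply: measurable_indic; exact: measurableI.
exists 1 => x; rewrite mul1r ger0_norm ?indicE// in_setI.
by case: (x \in D); rewrite ?andbF// andbT; case: (x \in A).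
Qed.

Lemma bounded_on0 D : bounded_on D (cst 0).
Proof. by split => //; exists 0 => x; rewrite normr0 mul0r. Qed.

Lemma bounded_on_out D f x : bounded_on D f -> ~ D x -> f x = 0.
Proof.
move=> [_ [M fM]] nDx; apply/eqP; rewrite -normr_le0 (le_trans (fM x))//.
by rewrite indicE memNset// mulr0.
Qed.

Lemma le_bounded_on D f g : measurable_fun setT g -> bounded_on D f ->
  (forall x, `|g x| <= `|f x|) -> bounded_on D g.
Proof.
by move=> mg [_ [M fM]] gf; split => //; exists M => x; exact: le_trans (fM x).
Qed.

Lemma bounded_onS D A f : D `<=` A -> bounded_on D f -> bounded_on A f.
Proof.
move=> DA [mf [M fM]]; split => //; exists `|M| => x.
apply: (le_trans (fM x)); have [Dx|nDx] := pselect (D x).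
  by rewrite !indicE !mem_set//; [rewrite !mulr1 ler_norm|exact: DA].
by rewrite indicE memNset// mulr0 mulr_ge0.
Qed.

Lemma integrable_bounded_on (m : {measure set T -> \bar R}) D f h :
  bounded_on D f -> m.-integrable setT (EFin \o h) ->
  m.-integrable setT (fun x => (f x * h x)%:E).
Proof.
move=> [mf [M fM]] ih.
have mh : measurable_fun setT h by apply/measurable_EFinP; exact: measurable_int ih.
apply: (le_integrable measurableT _ _ (integrableZl measurableT `|M| ih)).
  by apply/measurable_EFinP; exact: measurable_funM.
move=> x _; rewrite /= lee_fin !normrM normr_id ler_wpM2r//.
apply: (le_trans (fM x)).
by rewrite indicE; case: (_ \in _); rewrite ?mulr1 ?ler_norm// mulr0.
Qed.

End bounded_functionals.

Section functional_density.
Context d (T : measurableType d) (R : realType)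
  (m : {sigma_finite_measure set T -> \bar R}) (D : set T).
Hypothesis mD : measurable D.
Variable l : (T -> R) -> R.
Hypothesis l_lin : forall a f g, bounded_on D f -> bounded_on D g ->
  l (fun x => a * f x + g x) = a * l f + l g.
Hypothesis l_ae : forall f, bounded_on D f -> ae_eq m setT f (cst 0) -> l f = 0.
Hypothesis l_cvg : forall (f : nat -> T -> R) F, bounded_on D F ->
  (forall n, measurable_fun setT (f n)) -> (forall n x, `|f n x| <= F x) ->
  (forall x, f n x @[n --> \oo] --> 0) -> l (f n) @[n --> \oo] --> 0.

Let l_sub f g : bounded_on D f -> bounded_on D g ->
  l (fun x => f x - g x) = l f - l g.
Proof.
move=> bf bg; rewrite (_ : (fun x => f x - g x) = (fun x => -1 * g x + f x)).
  by rewrite l_lin// mulN1r addrC.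
by apply/funext => x; rewrite mulN1r addrC.
Qed.

(** Intersecting with D makes this a finite charge on all measurable sets, although [l] is
    controlled only on functions carried by D. *)
Let nu (A : set T) : \bar R := (l (\1_(A `&` D)))%:E.

Let l_indicU A B : measurable A -> measurable B -> A `&` B = set0 ->
  l (\1_((A `|` B) `&` D)) = l (\1_(A `&` D)) + l (\1_(B `&` D)).
Proof.
move=> mA mB AB0.
have -> : \1_((A `|` B) `&` D) = (fun x => 1 * \1_(A `&` D) x + \1_(B `&` D) x : R).
  apply/funext => x; rewrite mul1r !indicE !in_setI in_setU.
  have : x \notin A `&` B by apply/negP; rewrite AB0 inE.
  by rewrite in_setI; case: (_ \in A); case: (_ \in B); case: (_ \in D); rewrite ?addr0 ?add0r.
by rewrite l_lin ?mul1r//; exact: bounded_on_indic.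
Qed.

Let l0 (f : T -> R) : f = cst 0 -> l f = 0.
Proof. by move=> ->; apply: l_ae; [exact: bounded_on0|exact: aeW]. Qed.

Let nu0 : nu set0 = 0%E.
Proof.
rewrite /nu l0// set0I; apply/funext => x.
by rewrite indicE memNset.
Qed.

Let nu_fin A : measurable A -> nu A \is a fin_num.
Proof. by []. Qed.

(** The tails [B n] decrease to the empty set and their indicators on D are dominated by that of D,
    so [l_cvg] sends their charge to 0. *)
Let nu_sigma_additive : semi_sigma_additive nu.
Proof.
move=> F mF tF mUF.
pose G n := \bigcup_(i < n) F i.
have mG n : measurable (G n) by exact: bigcup_measurable.
have sumE n : (\sum_(0 <= i < n) nu (F i))%E = nu (G n).
  elim: n => [|n IH]; first by rewrite big_geq// /G bigcup0.
  rewrite big_nat_recr//= IH /nu -EFinD -l_indicU//.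
    by congr (l (\1_(_ `&` _)))%:E; rewrite /G !bigcup_mkord big_ord_recr.
  rewrite -subset0 => x [[i /= ni Fi] Fn].
  by have := tF i n Logic.I Logic.I (ex_intro _ x (conj Fi Fn)) => /eqP; rewrite ltn_eqF.
under eq_fun do rewrite sumE.
apply: cvg_EFin; first exact: nearW.
pose B n := \bigcup_i F i `\` G n.
have mB n : measurable (B n) by exact: measurableD.
have BE n : l (\1_(G n `&` D)) = l (\1_(\bigcup_i F i `&` D)) - l (\1_(B n `&` D)).
  apply/eqP; rewrite eq_sym subr_eq -l_indicU// /B ?setDIK// setDUK//.
  by move=> x [i _ Fi]; exists i.
suff lB : l (\1_(B n `&` D)) @[n --> \oo] --> 0.
  have := cvgB (cvg_cst (l (\1_(\bigcup_i F i `&` D)))) lB.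
  rewrite subr0; suff -> : fine \o (fun n => nu (G n)) =
      cst (l (\1_(\bigcup_i F i `&` D))) - (fun n => l (\1_(B n `&` D))).
    by move=> h; exact: h.
  by apply/funext => n; rewrite /= BE.
apply: (@l_cvg (fun n => \1_(B n `&` D)) _ (bounded_on_indic R mD measurableT)).
- by move=> n; apply: measurable_indic; exact: measurableI.
- move=> n x; rewrite !indicE ger0_norm// ler_nat !in_setI in_setT.
  by case: (x \in D); rewrite ?andbF ?andbT ?leq_b1.
- move=> x; have [[i _ Fi]|nF] := pselect ((\bigcup_i F i) x).
    apply: cvg_near_cst; exists i.+1 => // n /= ni.
    rewrite indicE memNset// => -[[_ nG] _]; apply: nG; exists i => //.
  apply: cvg_near_cst; apply: nearW => n.
  by rewrite indicE memNset// => -[[? _] _].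
Qed.

HB.instance Definition _ := isCharge.Build _ _ _ nu nu0 nu_fin nu_sigma_additive.

Let nu_dom : nu `<< m.
Proof.
apply/null_content_dominatesP => A mA A0; rewrite /nu l_ae//.
  exact: bounded_on_indic.
exists A; split => // x /= h; apply: contrapT => nAx; apply: h => _.
by rewrite indicE memNset// => -[].
Qed.

Import HBNNSimple.

(** The Radon-Nikodym derivative of [nu] represents [l] on indicators, hence on simple functions by
    linearity, and on nonnegative bounded functions by monotone approximation; the general case
    splits f into its positive and negative parts. *)
Lemma functional_density : exists h : T -> R,
  m.-integrable setT (EFin \o h) /\
  forall f, bounded_on D f -> l f = \int[m]_x (f x * h x).
Proof.
pose h0 := Radon_Nikodym nu m.
pose h := fine \o h0.
have hE : EFin \o h = h0.
  by apply/funext => x /=; rewrite fineK// Radon_Nikodym_fin_num.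
have ih : m.-integrable setT (EFin \o h) by rewrite hE; exact: Radon_Nikodym_integrable.
exists h; split => //.
have ifh f : bounded_on D f -> m.-integrable setT (EFin \o (fun x => f x * h x)).
  by move=> bf; exact: integrable_bounded_on bf ih.
pose good f := bounded_on D f /\ l f = \int[m]_x (f x * h x).
have good_lin a f g : good f -> good g -> good (fun x => a * f x + g x).
  move=> [bf lf] [bg lg]; split; first exact: bounded_on_lin.
  rewrite l_lin// lf lg -RintegralZl//; last exact: ifh.
  rewrite -RintegralD//; last 2 first.
  - by have := ifh _ (bounded_on_lin a bf (bounded_on0 _ D));
      apply: eq_integrable => // x _ /=; rewrite addr0 mulrA.
  - exact: ifh.
  by apply: eq_Rintegral => x _; rewrite mulrDl mulrA.
have good_indic A : measurable A -> good (\1_(A `&` D)).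
  move=> mA; have mAD : measurable (A `&` D) by exact: measurableI.
  split; first exact: bounded_on_indic.
  have : nu (A `&` D) = (\int[m]_(x in A `&` D) h0 x)%E by exact: Radon_Nikodym_integral.
  rewrite /nu -setIA setIid integral_mkcond => /(congr1 fine) /= ->.
  congr fine; apply: eq_integral => x _; rewrite patchE indicE.
  by case: ifPn => _; rewrite ?mul1r ?mul0r// -[RHS]/((EFin \o h) x) hE.
have good_sum (s : seq R) (A : R -> set T) : (forall y, measurable (A y)) ->
    good (fun x => \sum_(y <- s) y * \1_(A y `&` D) x).
  move=> mA; elim: s => [|y s IH].
    under eq_fun do rewrite big_nil.
    split; first exact: bounded_on0.
    rewrite l0//; under eq_Rintegral do rewrite mul0r.
    by rewrite /Rintegral integral0.
  under eq_fun do rewrite big_cons.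
  by apply: good_lin => //; exact: good_indic.
have good_ge0 f : bounded_on D f -> (forall x, 0 <= f x) -> good f.
  move=> bf f0; split => //.
  have mf : measurable_fun setT (EFin \o f) by apply/measurable_EFinP; exact: bf.1.
  pose g := nnsfun_approx measurableT mf.
  have g_cvg x : g n x @[n --> \oo] --> f x.
    have f0' y : setT y -> (0 <= (EFin \o f) y)%E by rewrite lee_fin.
    by have /fine_cvgP[_] := cvg_nnsfun_approx measurableT mf f0' (x := x) Logic.I.
  have g_ge0 n x : 0 <= g n x by exact: fun_ge0.
  have gf n x : g n x <= f x.
    have <- : limn (g^~ x) = f x by apply/cvg_lim => //; exact: g_cvg.
    apply: nondecreasing_cvgn_le; last by apply/cvg_ex; exists (f x); exact: g_cvg.
    by move=> i j ij; have /lefP := nd_nnsfun_approx measurableT mf ij; exact.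
  have mg n : measurable_fun setT (g n) by exact: measurable_funP.
  have bg n : bounded_on D (g n).
    by apply: (le_bounded_on (mg n) bf) => x; rewrite !ger0_norm.
  have good_g n : good (g n).
    have -> : (g n : T -> R) = (fun x => \sum_(y <- finmap.enum_fset (fset_set (range (g n))))
        y * \1_(g n @^-1` [set y] `&` D) x).
      apply/funext => x; have [Dx|nDx] := pselect (D x).
        rewrite fimfunE fsbig_finite//=; apply: eq_bigr => y _.
        by rewrite !indicE in_setI (mem_set Dx) andbT.
      rewrite (bounded_on_out (bg n) nDx) big1// => y _.
      by rewrite indicE memNset ?mulr0// => -[].
    by apply: good_sum => y; exact: measurable_funPTI.
  have cvl : l (g n) @[n --> \oo] --> l f.
    (* [l_cvg] concerns sequences tending to 0, so it is applied to the remainders, which f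
       dominates. *)
    have : l (fun x => f x - g n x) @[n --> \oo] --> 0.
      apply: (l_cvg (F := f) (f := fun n x => f x - g n x)) => //.
      - by move=> n; apply: measurable_funB => //; exact: bf.1.
      - by move=> n x; rewrite ger0_norm ?subr_ge0// gerBl.
      - move=> x; rewrite -(subrr (f x)); apply: cvgB; first exact: cvg_cst.
        exact: g_cvg.
    move=> /(cvgB (cvg_cst (l f))); rewrite subr0 => h1.
    suff -> : (fun n => l (g n)) = cst (l f) - (fun n => l (fun x => f x - g n x)).
      exact: h1.
    by apply/funext => n; rewrite -[RHS]/(l f - _) l_sub// subKr.
  have cvI : (\int[m]_x (g n x * h x)) @[n --> \oo] --> \int[m]_x (f x * h x).
    have ifh' : m.-integrable setT (fun x => (f x * `|h x|)%:E).
      exact: integrable_bounded_on bf (integrable_norm ih).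
    have mgh n : measurable_fun setT (fun x => (g n x * h x)%:E) by exact: measurable_int (ifh _ (bg n)).
    have mfh : measurable_fun setT (fun x => (f x * h x)%:E) by exact: measurable_int (ifh _ bf).
    have cvp : {ae m, forall x, setT x -> (g n x * h x)%:E @[n --> \oo] --> (f x * h x)%:E}.
      apply: aeW => x _; apply: cvg_EFin; first exact: nearW.
      by apply: cvgM; [exact: g_cvg|exact: cvg_cst].
    have [|_ _ cv] := dominated_convergence measurableT mgh mfh cvp ifh'.
      apply: aeW => x n _; rewrite lee_fin normrM ger0_norm//.
      by rewrite ler_wpM2r.
    by apply: fine_cvg; rewrite /Rintegral fineK//; exact: integrable_fin_num (ifh _ bf).
  have lgE : (fun n => l (g n)) = (fun n => \int[m]_x (g n x * h x)).
    by apply/funext => n; exact: (good_g n).2.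
  by move: cvl; rewrite lgE => cvl; exact: cvg_unique cvl cvI.
move=> f bf.
have bp : bounded_on D f^\+.
  apply: (le_bounded_on _ bf); first by apply: measurable_funrpos; exact: bf.1.
  by move=> x; rewrite ger0_norm ?funrpos_ge0// /funrpos ge_max ler_norm normr_ge0.
have bn : bounded_on D f^\-.
  apply: (le_bounded_on _ bf); first by apply: measurable_funrneg; exact: bf.1.
  by move=> x; rewrite ger0_norm ?funrneg_ge0// /funrneg ge_max -normrN ler_norm normr_ge0.
have -> : f = (fun x => -1 * f^\- x + f^\+ x).
  by rewrite -{1}(funrposBneg f); apply/funext => x; rewrite mulN1r addrC.
by apply: (good_lin _ _ _ _ _).2; exact: good_ge0.
Qed.

End functional_density.

(** * Gluing densities over the layers of an exhaustion *)

Section functional_density_glue.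
Context d (T : measurableType d) (R : realType)
  (m : {sigma_finite_measure set T -> \bar R}) (H : set T) (N : T -> nat).
Let E n := H `&` [set x | N x = n].
Let K n := H `&` [set x | (N x < n)%N].
Hypothesis mE : forall n, measurable (E n).
Variable l : (T -> R) -> R.
Hypothesis l_lin : forall n a f g, bounded_on (K n) f -> bounded_on (K n) g ->
  l (fun x => a * f x + g x) = a * l f + l g.
Hypothesis l_ae : forall n f, bounded_on (K n) f -> ae_eq m setT f (cst 0) -> l f = 0.
Hypothesis l_cvg : forall n (f : nat -> T -> R) F, bounded_on (K n) F ->
  (forall n, measurable_fun setT (f n)) -> (forall n x, `|f n x| <= F x) ->
  (forall x, f n x @[n --> \oo] --> 0) -> l (f n) @[n --> \oo] --> 0.

Let EK n : E n `<=` K n.+1.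
Proof. by move=> x [Hx <-]; split => /=. Qed.

Let K0 : K 0 = set0. Proof. by rewrite -subset0 => x []. Qed.

Let KS n : K n.+1 = K n `|` E n.
Proof.
apply/seteqP; split => [x [Hx /=]|x [[Hx /= h]|[Hx /= <-]]]; last 2 first.
- by split => //=; rewrite ltnS ltnW.
- by split => /=.
by rewrite ltnS leq_eqVlt => /orP[/eqP|]; [right|left].
Qed.

Let mK n : measurable (K n).
Proof. by elim: n => [|n IH]; rewrite ?K0 // KS; exact: measurableU. Qed.

(** The layers [E n] are disjoint, so their densities need no compatibility. A function carried by
    [K n] meets finitely many layers, which permits induction on n and makes f h integrable even
    when h is not. *)
Lemma functional_density_glue : exists2 h : T -> R, measurable_fun setT h &
  forall n f, bounded_on (K n) f ->
    m.-integrable setT (fun x => (f x * h x)%:E) /\ l f = \int[m]_x (f x * h x).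
Proof.
have dens n : exists h : T -> R, m.-integrable setT (EFin \o h) /\
    forall f, bounded_on (E n) f -> l f = \int[m]_x (f x * h x).
  apply: functional_density => //.
  - move=> a f g bf bg; apply: (l_lin (n := n.+1)); exact: bounded_onS (@EK n) _.
  - move=> f bf; apply: (l_ae (n := n.+1)); exact: bounded_onS (@EK n) _.
  - move=> f F bF; apply: (l_cvg (n := n.+1)); exact: bounded_onS (@EK n) _.
have /choice[hh Hhh] := dens.
have mhh n : measurable_fun setT (hh n).
  by apply/measurable_EFinP; exact: measurable_int (Hhh n).1.
pose h := (fun x => hh (N x) x) \_ H.
have HE : H = \bigcup_n E n.
  by apply/seteqP; split => [x Hx|x [n _ []]//]; exists (N x).
have mH : measurable H by rewrite HE; exact: bigcup_measurable.
have mh : measurable_fun setT h.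
  apply/(measurable_restrictT _ mH); rewrite HE.
  apply/(measurable_fun_bigcup _ mE) => n.
  apply: (eq_measurable_fun (hh n)); last exact: measurable_funTS.
  by move=> x; rewrite inE => -[_ /= ->].
exists h => //; elim=> [|n IH] f.
  rewrite K0 => bf; have f0 : f = cst 0.
    by apply/funext => x; exact: bounded_on_out bf _.
  split; first by rewrite f0; under eq_fun do rewrite mul0r; exact: integrable0.
  rewrite (l_ae (n := 0%N)) ?K0//; last by rewrite f0; exact: aeW.
  by rewrite f0; under eq_Rintegral do rewrite mul0r; rewrite /Rintegral integral0.
move=> bf.
have bcut A : measurable A -> bounded_on A (fun x => f x * \1_A x).
  move=> mA; have [mf [M fM]] := bf; split.
    by apply: measurable_funM => //; exact: measurable_indic.
  exists `|M| => x; rewrite normrM [X in _ * X]ger0_norm ?indicE// ler_wpM2r//.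
  apply: (le_trans (fM x)); rewrite indicE; case: (_ \in _); rewrite ?mulr1 ?ler_norm//.
  by rewrite mulr0.
have bK := bcut _ (mK n); have bE := bcut _ (mE n).
have fE : f = (fun x => 1 * (f x * \1_(K n) x) + f x * \1_(E n) x).
  apply/funext => x; rewrite mul1r -mulrDr.
  have [Kx|nKx] := pselect (K n.+1 x); last first.
    by rewrite (bounded_on_out bf nKx) mul0r.
  have : K n.+1 x by [].
  rewrite KS => -[Kx'|Ex].
    rewrite !indicE mem_set// memNset ?addr0 ?mulr1//.
    by move=> [_ /= Nx]; move: Kx' => [_ /=]; rewrite Nx ltnn.
  rewrite !indicE memNset ?mem_set// ?add0r ?mulr1//.
  by move=> [_ /=]; rewrite Ex.2 ltnn.
have [iK lK] := IH _ bK.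
have EhE x : f x * \1_(E n) x * hh n x = f x * \1_(E n) x * h x.
  have [Ex|nEx] := pselect (E n x); last by rewrite indicE memNset// mulr0 !mul0r.
  by rewrite /h patchE mem_set ?Ex.2//; exact: Ex.1.
have iE : m.-integrable setT (fun x => (f x * \1_(E n) x * h x)%:E).
  under eq_fun do rewrite -EhE.
  exact: integrable_bounded_on bE (Hhh n).1.
have lE : l (fun x => f x * \1_(E n) x) = \int[m]_x (f x * \1_(E n) x * h x).
  by rewrite (Hhh n).2//; apply: eq_Rintegral => x _; exact: EhE.
have fhE x : f x * h x = f x * \1_(K n) x * h x + f x * \1_(E n) x * h x.
  by rewrite {1}fE mul1r mulrDl.
split.
  under eq_fun do rewrite fhE EFinD.
  exact: integrableD.
rewrite {1}fE (l_lin (n := n.+1)); last 2 first.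
- by apply: bounded_onS bK; rewrite KS; left.
- by apply: bounded_onS bE; exact: EK.
under [RHS]eq_Rintegral do rewrite fhE.
by rewrite mul1r RintegralD// lK lE.
Qed.

End functional_density_glue.

(** * Complex-valued integrals *)

Section complex_integration.
Context {R : realType}.
Implicit Types z w : R[i].

Lemma normc_ge0 z : 0 <= normc z.
Proof. by case: z => a b; exact: sqrtr_ge0. Qed.

Lemma normc_Complex_real (a : R) : normc (Complex a 0) = `|a|.
Proof. by rewrite /normc expr0n addr0 sqrtr_sqr. Qed.

Lemma normr_Re_le z : `|complex.Re z| <= normc z.
Proof. by case: z => a b /=; rewrite -sqrtr_sqr ler_wsqrtr// lerDl sqr_ge0. Qed.

Lemma normr_Im_le z : `|complex.Im z| <= normc z.
Proof. by case: z => a b /=; rewrite -sqrtr_sqr ler_wsqrtr// lerDr sqr_ge0. Qed.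

Lemma normc_le_ReIm z : normc z <= `|complex.Re z| + `|complex.Im z|.
Proof.
case: z => a b /=; rewrite -[leRHS]ger0_norm// -sqrtr_sqr ler_wsqrtr//.
rewrite sqrrD !real_normK ?num_real// addrAC lerDl.
by rewrite mulrn_wge0// mulr_ge0.
Qed.

Lemma normc_conjc z : normc (conjc z) = normc z.
Proof. by case: z => a b /=; rewrite sqrrN. Qed.

Context d (T : measurableType d) (m : {measure set T -> \bar R}) (D : set T).
Hypothesis mD : measurable D.
Implicit Types F : T -> R[i].

Definition cmeasurable F := measurable_fun D (fun x => complex.Re (F x)) /\
  measurable_fun D (fun x => complex.Im (F x)).

Definition cintegrable F :=
  m.-integrable D (fun x => (complex.Re (F x))%:E) /\
  m.-integrable D (fun x => (complex.Im (F x))%:E).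

Definition cintegral F : R[i] :=
  Complex (\int[m]_(x in D) complex.Re (F x)) (\int[m]_(x in D) complex.Im (F x)).

Lemma cmeasurable_normc F : cmeasurable F -> measurable_fun D (fun x => normc (F x)).
Proof.
move=> [mRe mIm].
have -> : (fun x => normc (F x)) =
    (fun x => (complex.Re (F x) ^+ 2 + complex.Im (F x) ^+ 2) `^ 2^-1).
  apply/funext => x; rewrite powR12_sqrt ?addr_ge0 ?sqr_ge0//.
  by case: (F x).
apply: (measurableT_comp (measurable_powR _)).
by apply: measurable_funD; exact: measurable_funX.
Qed.

Lemma cmeasurableM_conj F G : cmeasurable F -> cmeasurable G ->
  cmeasurable (fun x => F x * conjc (G x)).
Proof.
move=> [mRF mIF] [mRG mIG]; split.
  have -> : (fun x => complex.Re (F x * conjc (G x))) = (fun x =>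
      complex.Re (F x) * complex.Re (G x) - complex.Im (F x) * - complex.Im (G x)).
    by apply/funext => x; case: (F x) => a b; case: (G x) => c e.
  apply: measurable_funB; apply: measurable_funM => //.
  exact: measurableT_comp mIG.
have -> : (fun x => complex.Im (F x * conjc (G x))) = (fun x =>
    complex.Re (F x) * - complex.Im (G x) + complex.Im (F x) * complex.Re (G x)).
  by apply/funext => x; case: (F x) => a b; case: (G x) => c e.
apply: measurable_funD; apply: measurable_funM => //.
exact: measurableT_comp mIG.
Qed.

Lemma cmeasurable_lin (a : R[i]) F G : cmeasurable F -> cmeasurable G ->
  cmeasurable (fun x => a * F x + G x).
Proof.
case: a => a b [mRF mIF] [mRG mIG]; split.
  have -> : (fun x => complex.Re (Complex a b * F x + G x)) = (fun x =>
      a * complex.Re (F x) - b * complex.Im (F x) + complex.Re (G x)).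
    by apply/funext => x; case: (F x) => ? ?; case: (G x).
  apply: measurable_funD => //; apply: measurable_funB; exact: measurable_funM.
have -> : (fun x => complex.Im (Complex a b * F x + G x)) = (fun x =>
    a * complex.Im (F x) + b * complex.Re (F x) + complex.Im (G x)).
  by apply/funext => x; case: (F x) => ? ?; case: (G x).
apply: measurable_funD => //; apply: measurable_funD; exact: measurable_funM.
Qed.

Lemma cintegrable_normc F : cmeasurable F ->
  (\int[m]_(x in D) (normc (F x))%:E < +oo)%E -> cintegrable F.
Proof.
move=> mF fin.
have iN : m.-integrable D (fun x => (normc (F x))%:E).
  apply/integrableP; split; first exact/measurable_EFinP/cmeasurable_normc.
  by under eq_integral do rewrite gee0_abs ?lee_fin ?normc_ge0//.
split; apply: (le_integrable mD _ _ iN).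
- by apply/measurable_EFinP; exact: mF.1.
- move=> x _; rewrite lee_fin [leRHS]ger0_norm ?normc_ge0//; exact: normr_Re_le.
- by apply/measurable_EFinP; exact: mF.2.
- move=> x _; rewrite lee_fin [leRHS]ger0_norm ?normc_ge0//; exact: normr_Im_le.
Qed.

Lemma cintegral_lin (a : R[i]) F G : cintegrable F -> cintegrable G ->
  cintegral (fun x => a * F x + G x) = a * cintegral F + cintegral G.
Proof.
case: a => a b [iRF iIF] [iRG iIG].
have iZ (c : R) (f : T -> R) : m.-integrable D (EFin \o f) ->
    m.-integrable D (EFin \o (fun x => c * f x)) by exact: integrableZl.
have -> : Complex a b * cintegral F + cintegral G = Complex
   (a * \int[m]_(x in D) complex.Re (F x) - b * \int[m]_(x in D) complex.Im (F x)
     + \int[m]_(x in D) complex.Re (G x))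
   (a * \int[m]_(x in D) complex.Im (F x) + b * \int[m]_(x in D) complex.Re (F x)
     + \int[m]_(x in D) complex.Im (G x)) by [].
rewrite -!RintegralZl//.
rewrite -RintegralB//; [|exact: iZ|exact: iZ].
rewrite -RintegralD//; last exact: (integrableB mD (iZ a _ iRF) (iZ b _ iIF)).
rewrite -RintegralD//; [|exact: iZ|exact: iZ].
rewrite -RintegralD//; last exact: (integrableD mD (iZ a _ iIF) (iZ b _ iRF)).
by congr Complex; apply: eq_Rintegral => x _; case: (F x) => ? ?; case: (G x).
Qed.

(** The real and the imaginary part are bounded separately; the factor 2 is harmless for an
    equivalence of norms. *)
Lemma normc_cintegral_le F : cmeasurable F ->
  ((normc (cintegral F))%:E <= 2%:E * \int[m]_(x in D) (normc (F x))%:E)%E.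
Proof.
move=> mF; have mN := cmeasurable_normc mF.
have [fin|] := ltP (\int[m]_(x in D) (normc (F x))%:E)%E +oo%E; last first.
  by rewrite leye_eq => /eqP ->; rewrite gt0_muley ?lte_fin// leey.
have [iRe iIm] := cintegrable_normc mF fin.
apply: (@le_trans _ _ (`|\int[m]_(x in D) complex.Re (F x)| +
    `|\int[m]_(x in D) complex.Im (F x)|)%:E); first exact: (normc_le_ReIm (cintegral F)).
rewrite EFinD mule_natl mule2n; apply: leeD.
  rewrite EFin_normr_Rintegral//; apply: (le_trans (le_abse_integral _ mD _)).
    exact: measurable_int iRe.
  apply: ge0_le_integral => //.
  - by apply: measurableT_comp => //; apply/measurable_EFinP; exact: mF.1.
  - exact/measurable_EFinP.
  - by move=> x _; rewrite lee_fin; exact: normr_Re_le.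
rewrite EFin_normr_Rintegral//; apply: (le_trans (le_abse_integral _ mD _)).
  exact: measurable_int iIm.
apply: ge0_le_integral => //.
- by apply: measurableT_comp => //; apply/measurable_EFinP; exact: mF.2.
- exact/measurable_EFinP.
- by move=> x _; rewrite lee_fin; exact: normr_Im_le.
Qed.

End complex_integration.

(** * Exhaustion of the half-space *)

Section conjugate_exponent.
Context {R : realType} (q : R).
Hypothesis q_gt1 : 1 < q.
Let q' := q / (q - 1).

Let q1_gt0 : 0 < q - 1. Proof. by rewrite subr_gt0. Qed.
Let q_gt0 : 0 < q. Proof. exact: lt_trans ltr01 q_gt1. Qed.

Lemma conjugate_gt0 : 0 < q'. Proof. by rewrite divr_gt0. Qed.

Lemma conjugate_sum : q^-1 + q'^-1 = 1.
Proof. by rewrite /q'; field; rewrite !gt_eqF. Qed.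

(** Turns the q-th power of the modulus of |g|^(q'-2) g into |g|^q'. *)
Lemma conjugate_subM : (q' - 1) * q = q'.
Proof. by rewrite /q'; field; rewrite gt_eqF. Qed.

(** The exponent of 2B lam for lam = (2B)^(1/(q-1)), the choice made in
    [tent_normoo_le_functional]. *)
Lemma conjugate_addV : 1 + (q - 1)^-1 = q'.
Proof. by rewrite /q'; field; rewrite gt_eqF. Qed.

Lemma conjugate_gt1 : 1 < q'.
Proof. by rewrite -conjugate_addV ltrDl invr_gt0. Qed.

End conjugate_exponent.

Lemma dt_over_t_itv_fin (R : realType) (c e : R) : 0 < c ->
  (dt_over_t (`[c, e] : set (measurableTypeR R)) < +oo)%E.
Proof.
move=> c0; rewrite /dt_over_t setIidl; last first.
  by move=> t /=; rewrite !in_itv/= andbT => /andP[/(lt_le_trans c0)].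
have mI : measurable (`[c, e] : set (measurableTypeR R)) by exact: measurable_itv.
apply: (@le_lt_trans _ _ (\int[lebesgue_measure]_(t in `[c, e]) (cst c^-1%:E) t)%E).
  apply: ge0_le_integral => //.
  - move=> t /=; rewrite in_itv/= => /andP[ct _].
    by rewrite lee_fin invr_ge0 (le_trans (ltW c0)).
  - apply/measurable_EFinP.
    apply: (eq_measurable_fun (fun t : measurableTypeR R => t `^ (-1))); last first.
      by apply: measurable_funTS; exact: measurable_powR.
    move=> t; rewrite inE/= in_itv/= => /andP[ct _].
    by rewrite powR_inv1// (le_trans (ltW c0)).
  - move=> t /=; rewrite in_itv/= => /andP[ct _].
    by rewrite lee_fin lef_pV2 ?posrE// (lt_le_trans c0).
rewrite integral_cst//= lebesgue_measure_itv/=; case: ifP => _.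
  by rewrite -EFinD -EFinM ltry.
by rewrite mule0.
Qed.

Section exhaustion.
Context {R : realType} {X : pmetricType R}
  (mu : {sigma_finite_measure set (borel X) -> \bar R}) (alpha : R).
Hypothesis mu_ball : forall (x : X) (r : R), 0 < r ->
  (0 < mu (ball x r))%E /\ (mu (ball x r) < +oo)%E.
Hypothesis alpha_gt0 : 0 < alpha.

Local Notation P := (borel X * measurableTypeR R)%type.
Local Notation hs := (@halfspace R X).
Local Notation m := (halfspace_measure mu).
Local Notation mhs := (@measurable_halfspace R X).

(* [depth p < n] forces d(x0, y) < n and 1/n < t < n for p = (y, t). *)
Definition depth (p : P) : nat :=
  Num.truncn (mdist (point : X) (p.1 : X) + p.2 + (p.2)^-1).

(** Given through the integer [depth], whose level sets are the disjoint layers required for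
    gluing. *)
Definition exhaust n : set P := hs `&` [set p | (depth p < n)%N].

Let rho (p : P) : R := mdist (point : X) (p.1 : X) + p.2 + (p.2)^-1.

Let rho_ge0 p : hs p -> 0 <= rho p.
Proof. by move=> /= hp; rewrite !addr_ge0 ?invr_ge0 ?mdist_ge0 ?ltW. Qed.

Let measurable_rho : measurable_fun hs rho.
Proof.
have msnd : measurable_fun hs (fun p : P => p.2 : R).
  by apply: measurable_funTS; exact: measurable_snd.
have mfst : measurable_fun hs (fun p : P => mdist (point : X) (p.1 : X)).
  apply: measurable_funTS; exact: (measurableT_comp (measurable_mdist point)
    (@measurable_fst _ _ (borel X) (measurableTypeR R))).
apply: measurable_funD; first exact: measurable_funD.
apply: (eq_measurable_fun (fun p : P => p.2 `^ (-1))); last first.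
  exact: (measurableT_comp (measurable_powR _)).
by move=> p; rewrite inE => hp; rewrite powR_inv1// ltW.
Qed.

Let exhaustE n : exhaust n = hs `&` [set p | rho p < n%:R].
Proof.
apply/seteqP; split => p [hp /=]; have r0 := rho_ge0 hp.
  by rewrite /depth -/(rho p) truncn_lt_nat.
by move=> h; split => //=; rewrite /depth -/(rho p) truncn_lt_nat.
Qed.

Lemma measurable_exhaust n : measurable (exhaust n).
Proof.
rewrite exhaustE (_ : [set _ | _] = rho @^-1` `]-oo, n%:R[).
  by apply: measurable_rho; [exact: mhs|exact: measurable_itv].
by apply/seteqP; split => p /=; rewrite in_itv.
Qed.

Lemma measurable_depth n : measurable (hs `&` [set p | depth p = n]).
Proof.
rewrite (_ : _ `&` _ = exhaust n.+1 `\` exhaust n).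
  by apply: measurableD; exact: measurable_exhaust.
apply/seteqP; split => [p [hp /= pn]|p [[hp /= pn] np]].
  by split; [split => //=; rewrite pn|move=> [_ /=]; rewrite pn ltnn].
split => //=; apply/eqP; rewrite eqn_leq -ltnS pn leqNgt/=.
by apply/negP => h; exact: np.
Qed.

Lemma exhaust_hs n : exhaust n `<=` hs. Proof. by move=> p []. Qed.

Lemma halfspace_exhaust p : hs p -> exhaust (depth p).+1 p.
Proof. by move=> hp; split => /=. Qed.

Lemma exhaustS n k : (n <= k)%N -> exhaust n `<=` exhaust k.
Proof. by move=> nk p [hp /= h]; split => //=; exact: leq_trans nk. Qed.

Lemma measure_exhaust_fin n : (m (exhaust n) < +oo)%E.
Proof.
have [->|n0] := posnP n.
  by rewrite (_ : exhaust 0 = set0) ?measure0// -subset0 => p [].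
have nR0 : 0 < n%:R :> R by rewrite ltr0n.
have mB := measurable_mball (point : X) (n%:R : R).
have mI : measurable (`[n%:R^-1, n%:R] : set (measurableTypeR R)) by exact: measurable_itv.
apply: (@le_lt_trans _ _ (m ((ball (point : X) (n%:R : R) : set (borel X)) `*`
    (`[n%:R^-1, n%:R] : set (measurableTypeR R))))).
  apply: le_measure; rewrite ?inE.
  - exact: measurable_exhaust.
  - exact: measurableX.
  - rewrite exhaustE => -[y t] [hp]; rewrite /rho /= => h.
    have t0 : 0 < t := hp.
    have d0 := mdist_ge0 (point : X) (y : X).
    have tV0 : 0 < t^-1 by rewrite invr_gt0.
    split => /=; first by rewrite ballEmdist /=; lra.
    rewrite in_itv/=; apply/andP; split; last by lra.
    by rewrite -[leRHS]invrK lef_pV2 ?posrE//; lra.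
rewrite [m _](product_measure1E _ _ mB mI) lte_mul_pinfty//.
  by rewrite ge0_fin_numE//; exact: (mu_ball _ nR0).2.
by apply: dt_over_t_itv_fin; rewrite invr_gt0.
Qed.

Variable q : R.
Hypothesis q_gt1 : 1 < q.

Lemma tent1_exhaust_fin n (M : R) (phi : P -> R) : measurable_fun hs phi ->
  (forall p, hs p -> 0 <= phi p) -> (forall p, hs p -> phi p <= M * \1_(exhaust n) p) ->
  (tent1 mu alpha q phi < +oo)%E.
Proof.
move=> mphi phi0 phiM.
have key (a b t tV c : R) : 0 <= a -> 0 < t -> 0 < tV -> a + t + tV < c ->
    b < alpha * t -> a + b < (1 + alpha) * (c + 1).
  move=> a0 t0 tV0 h bt.
  have : alpha * t <= alpha * c by rewrite ler_pM2l//; lra.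
  by have := alpha_gt0; rewrite mulrDl mul1r mulrDr mulr1; lra.
(* If (y, t) lies in [exhaust n] and x sees it, then d(x0, x) < n + alpha n. The added 1 keeps the
   radius positive for n = 0. *)
set F := ball (point : X) ((1 + alpha) * (n%:R + 1)).
have F0 : 0 < (1 + alpha) * (n%:R + 1) by rewrite mulr_gt0 ?natr1 ?addr_gt0 ?ltr0n.
have mF : measurable (F : set (borel X)) by exact: measurable_mball.
apply: (le_lt_trans (tent1_local mu_ball alpha_gt0 q_gt1 ltr01 mF mphi phi0 _)).
  move=> x p nFx xp; have hp := incidence_halfspace alpha_gt0 xp.
  apply/eqP; rewrite eq_le phi0// andbT (le_trans (phiM p hp))//.
  rewrite indicE memNset ?mulr0//; rewrite exhaustE => -[_ /=]; rewrite /rho => h.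
  apply: nFx; rewrite /F ballEmdist /=.
  rewrite (le_lt_trans (metric_triangle _ (p.1 : X) _))// [mdist _ x]metric_sym.
  have p0 : 0 < p.2 := hp.
  have pV0 : 0 < (p.2)^-1 by rewrite invr_gt0.
  have d0 := mdist_ge0 (point : X) (p.1 : X).
  have xp' : mdist (x : X) (p.1 : X) < alpha * p.2 := xp.
  exact: (key _ _ _ _ _ d0 p0 pV0 h xp').
rewrite mul1e powR1 mul1e lte_add_pinfty//; first exact: (mu_ball _ F0).2.
apply: (@le_lt_trans _ _ (\int[m]_(p in hs) (`|M| * \1_(exhaust n) p)%:E)%E).
  apply: ge0_le_integral => //.
  - exact: mhs.
  - exact/measurable_EFinP.
  - apply/measurable_EFinP; apply: measurable_funM => //.
    by apply: measurable_indic; exact: measurable_exhaust.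
  - move=> p hp; rewrite lee_fin (le_trans (phiM _ hp))//.
    by rewrite ler_wpM2r ?ler_norm.
under eq_integral do rewrite EFinM.
have mind : measurable_fun hs (fun p => (\1_(exhaust n) p : R)%:E).
  by apply/measurable_EFinP; apply: measurable_indic; exact: measurable_exhaust.
rewrite (ge0_integralZl _ (measurable_halfspace (X := X)) mind)//.
rewrite integral_indic//; [|exact: mhs|exact: measurable_exhaust].
rewrite setIidl; last exact: exhaust_hs.
by rewrite lte_mul_pinfty ?lee_fin//; exact: measure_exhaust_fin.
Qed.

End exhaustion.

(** * Tent spaces and their pairing *)

Section tent_spaces_duality.
Context {R : realType} {X : pmetricType R}
  (mu : {sigma_finite_measure set (borel X) -> \bar R}) (alpha q C : R).
Hypothesis mu_ball : forall (x : X) (r : R), 0 < r ->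
  (0 < mu (ball x r))%E /\ (mu (ball x r) < +oo)%E.
Hypothesis alpha_gt0 : 0 < alpha.
Hypothesis q_gt1 : 1 < q.
Hypothesis C_gt0 : 0 < C.
Hypothesis mu_doubling : forall (x : X) (r : R), 0 < r ->
  (mu (ball x (2 * r)) <= C%:E * mu (ball x r))%E.

Local Notation P := (borel X * measurableTypeR R)%type.
Local Notation hs := (@halfspace R X).
Local Notation m := (halfspace_measure mu).
Local Notation mhs := (@measurable_halfspace R X).
Local Notation q' := (q / (q - 1)).
Local Notation T1 := (tent_space mu 1%:E q alpha).
Local Notation Too := (tent_space mu +oo%E q' alpha).
Local Notation N1 := (tent_norm mu 1%:E q alpha).
Local Notation Noo := (tent_norm mu +oo%E q' alpha).
Local Notation K := (@exhaust R X).
Implicit Types f g : P -> R[i].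

Let q_gt0 : 0 < q. Proof. exact: lt_trans ltr01 q_gt1. Qed.
Let q'_gt0 : 0 < q'. Proof. exact: conjugate_gt0. Qed.

Definition normcX f (p : P) := normc (f p) `^ q.

Lemma normcX_ge0 f p : hs p -> 0 <= normcX f p. Proof. by move=> _; exact: powR_ge0. Qed.

Lemma measurable_normcX f : cmeasurable hs f -> measurable_fun hs (normcX f).
Proof.
by move=> mf; apply: (measurableT_comp (measurable_powR _)); exact: cmeasurable_normc.
Qed.

Let ler_normc_powR (z w : R[i]) (r : R) : 0 < r -> normc z <= normc w ->
  normc z `^ r <= normc w `^ r.
Proof.
move=> r0 h; apply: (ge0_ler_powR (ltW r0)); last exact: h.
  by rewrite nnegrE normc_ge0.
by rewrite nnegrE normc_ge0.
Qed.

Lemma tent_norm1E f : N1 f = tent1 mu alpha q (normcX f).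
Proof.
rewrite /tent_norm Lnorm1; apply: eq_integral => x _.
rewrite gee0_abs ?poweR_ge0// /Aq; congr poweR.
rewrite coneE//; apply: eq_integral => p; rewrite inE => xp.
by rewrite EFinM inv_volE//; exact: xsection_incidence_sub xp.
Qed.

Lemma tent_norm1_ge0 f : (0 <= N1 f)%E. Proof. exact: Lnorm_ge0. Qed.

Lemma tent_space1P f : T1 f <-> cmeasurable hs f /\ (N1 f < +oo)%E.
Proof. by split => [[? ? ?]|[[? ?] ?]]; do ?split. Qed.

Lemma tent_space1_le f g : T1 f -> cmeasurable hs g ->
  (forall p, hs p -> normc (g p) <= normc (f p)) -> T1 g.
Proof.
move=> /tent_space1P[mf finf] mg gf; apply/tent_space1P; split; first exact: mg.
apply: le_lt_trans finf; rewrite !tent_norm1E.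
apply: (le_tent1 mu_ball alpha_gt0 q_gt1).
- exact: measurable_normcX.
- exact: measurable_normcX.
- exact: normcX_ge0.
- by move=> p hp; apply: ler_normc_powR; [exact: q_gt0|exact: gf].
Qed.

Lemma tent_norm1_cvg0 (f_ : nat -> P -> R[i]) f :
  (forall n, cmeasurable hs (f_ n)) -> T1 f ->
  (forall n p, hs p -> normc (f_ n p) <= normc (f p)) ->
  (forall p, hs p -> normc (f_ n p) @[n --> \oo] --> 0) ->
  (N1 (f_ n) @[n --> \oo] --> 0)%E.
Proof.
move=> mf_ /tent_space1P[mf finf] ff f0.
under eq_fun do rewrite tent_norm1E.
apply: (dominated_tent1 mu_ball alpha_gt0 q_gt1 (phi := normcX f)).
- by move=> n; exact: measurable_normcX.
- exact: measurable_normcX.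
- move=> n p hp; rewrite /normcX powR_ge0/=.
  by apply: ler_normc_powR; [exact: q_gt0|exact: ff].
- move=> p hp; have cv : ((normc (f_ n p))%:E `^ q @[n --> \oo] --> 0)%E.
    apply: cvg_poweR0 => //; first by move=> n; rewrite lee_fin normc_ge0.
    by apply: cvg_EFin; [exact: nearW|exact: f0].
  by have /fine_cvgP[_] := cv.
- by rewrite -tent_norm1E.
Qed.

(** The test functions: bounded and carried by a set of finite measure whose points are seen from a
    single ball, hence in the tent space. *)
Definition admissible n f := bounded_on (K n) (fun p => complex.Re (f p)) /\
  bounded_on (K n) (fun p => complex.Im (f p)).

Lemma admissible_cmeasurable n f : admissible n f -> cmeasurable hs f.
Proof. by move=> [[mRe _] [mIm _]]; split; exact: measurable_funTS. Qed.

Lemma admissible_tent_space1 n f : admissible n f -> T1 f.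
Proof.
move=> af; have mf := admissible_cmeasurable af; apply/tent_space1P.
split; first exact: mf.
have [[_ [M fM]] [_ [M' fM']]] := af.
rewrite tent_norm1E.
apply: (tent1_exhaust_fin mu_ball alpha_gt0 q_gt1 (n := n) (M := (`|M| + `|M'|) `^ q)).
- exact: measurable_normcX.
- exact: normcX_ge0.
move=> p hp; have [Kp|nKp] := pselect (K n p).
  rewrite indicE mem_set// mulr1; apply: ge0_ler_powR.
  - exact: ltW.
  - by rewrite nnegrE normc_ge0.
  - by rewrite nnegrE addr_ge0.
  - rewrite (le_trans (normc_le_ReIm _))// lerD//.
      by rewrite (le_trans (fM p))// indicE mem_set// mulr1 ler_norm.
    by rewrite (le_trans (fM' p))// indicE mem_set// mulr1 ler_norm.
rewrite indicE memNset// mulr0 /normcX.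
have /eqP -> : normc (f p) == 0.
  rewrite eq_le normc_ge0 andbT (le_trans (normc_le_ReIm _))//.
  by rewrite (bounded_on_out af.1 nKp) (bounded_on_out af.2 nKp) normr0 addr0.
by rewrite powR0// gt_eqF.
Qed.

(** The cut in size makes the restriction of f bounded, hence admissible; every point of the
    half-space belongs to the set for n large. *)
Definition cut_set f n : set P := K n `&` [set p | normc (f p) <= n%:R].

Lemma measurable_cut_set f n : cmeasurable hs f -> measurable (cut_set f n).
Proof.
move=> /cmeasurable_normc mf.
rewrite /cut_set (_ : K n `&` _ =
    K n `&` (hs `&` (fun p => normc (f p)) @^-1` `]-oo, n%:R])).
  by apply: measurableI; [exact: measurable_exhaust|apply: mf => //; exact: mhs].
apply/seteqP; split => [p [Kp /= h]|p [Kp [_ /=]]].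
  by split => //; split; [exact: exhaust_hs Kp|rewrite /= in_itv].
by rewrite in_itv.
Qed.

Lemma admissible_cut f n A : cmeasurable hs f -> measurable A ->
  A `<=` cut_set f n ->
  admissible n (fun p => Complex (\1_A p * complex.Re (f p)) (\1_A p * complex.Im (f p))).
Proof.
move=> [mRe mIm] mA Acut.
have b (u : P -> R) : measurable_fun hs u -> (forall p, `|u p| <= normc (f p)) ->
    bounded_on (K n) (fun p => \1_A p * u p).
  move=> mu_ uf; split.
    have -> : (fun p => \1_A p * u p) = (fun p => \1_A p * (u \_ hs) p).
      apply/funext => p; have [Ap|nAp] := pselect (A p); last first.
        by rewrite indicE memNset// !mul0r.
      by rewrite patchE mem_set//; apply: (@exhaust_hs _ _ n); exact: (Acut _ Ap).1.
    apply: measurable_funM; first exact: measurable_indic.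
    by apply/(measurable_restrictT _ mhs).
  exists n%:R => p; have [Ap|nAp] := pselect (A p); last first.
    by rewrite indicE memNset// mul0r normr0 mulr_ge0.
  rewrite !indicE !mem_set//; last exact: (Acut _ Ap).1.
  by rewrite mul1r mulr1 (le_trans (uf p))//; exact: (Acut _ Ap).2.
by split; apply: b => // p; [exact: normr_Re_le|exact: normr_Im_le].
Qed.

Let cut f n p : R[i] := Complex (\1_(cut_set f n) p * complex.Re (f p))
  (\1_(cut_set f n) p * complex.Im (f p)).

Let cutE f n p : cut_set f n p -> cut f n p = f p.
Proof. by move=> h; rewrite /cut indicE mem_set// !mul1r; case: (f p). Qed.

Let cutNE f n p : ~ cut_set f n p -> cut f n p = 0.
Proof. by move=> h; rewrite /cut indicE memNset// !mul0r. Qed.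

Let admissible_cut_fun f n : cmeasurable hs f -> admissible n (cut f n).
Proof. by move=> mf; apply: admissible_cut => //; exact: measurable_cut_set. Qed.

(** The remainder [r n] is dominated by |f| and vanishes at p once n exceeds both [depth p] and
    |f(p)|, so its norm tends to 0. The number L f - L' f equals L (r n) - L' (r n) for all n, hence
    is 0. *)
Lemma functional_eq_of_admissible L L' :
  bounded_linear_functional mu 1%:E q alpha L ->
  bounded_linear_functional mu 1%:E q alpha L' ->
  (forall n f, admissible n f -> L f = L' f) -> forall f, T1 f -> L f = L' f.
Proof.
move=> [_ Llin [B LB]] [_ L'lin [B' L'B']] LL' f T1f.
have /tent_space1P[mf _] := T1f.
pose r n p := -1 * cut f n p + f p.
have T1cut n : T1 (cut f n) := admissible_tent_space1 (admissible_cut_fun n mf).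
have mr n : cmeasurable hs (r n).
  apply: cmeasurable_lin => //.
  exact: admissible_cmeasurable (admissible_cut_fun n mf).
have rE n p : normc (r n p) <= normc (f p).
  rewrite /r; have [h|h] := pselect (cut_set f n p).
    by rewrite cutE// mulN1r addNr ComplexField.Normc.normc0 normc_ge0.
  by rewrite cutNE// mulr0 add0r.
have T1r n : T1 (r n) by apply: (tent_space1_le T1f (mr n)) => p _; exact: rE.
have r0 p : hs p -> normc (r n p) @[n --> \oo] --> 0.
  move=> hp; apply: cvg_near_cst.
  exists (maxn (depth p).+1 (Num.truncn (normc (f p))).+1) => // n /= nM.
  rewrite /r cutE ?mulN1r ?addNr ?ComplexField.Normc.normc0//; split.
    by apply: exhaustS (halfspace_exhaust hp); exact: leq_trans (leq_maxl _ _) nM.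
  rewrite /= (le_trans (ltW (truncnS_gt _)))// ler_nat.
  exact: leq_trans (leq_maxr _ _) nM.
have Nr := tent_norm1_cvg0 mr T1f (fun n p _ => rE n p) r0.
have Lr n : L f - L' f = L (r n) - L' (r n).
  rewrite /r (Llin _ _ _ (T1cut n) T1f) (L'lin _ _ _ (T1cut n) T1f).
  by rewrite (LL' n _ (admissible_cut_fun n mf)); ring.
have LN n : ((normc (L f - L' f))%:E <= (`|B| + `|B'|)%:E * N1 (r n))%E.
  rewrite (Lr n); apply: (@le_trans _ _ ((normc (L (r n)) + normc (L' (r n)))%:E)).
    by rewrite lee_fin (le_trans (le_normcD _ _))// normcN.
  rewrite EFinD EFinD ge0_muleDl ?lee_fin//; apply: leeD.
    apply: (le_trans (LB _ (T1r n))); apply: lee_wpmul2r; first exact: tent_norm1_ge0.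
    by rewrite lee_fin ler_norm.
  apply: (le_trans (L'B' _ (T1r n))); apply: lee_wpmul2r; first exact: tent_norm1_ge0.
  by rewrite lee_fin ler_norm.
have cv : ((`|B| + `|B'|)%:E * N1 (r n) @[n --> \oo] --> 0)%E.
  by rewrite -(mule0 (`|B| + `|B'|)%:E); exact: cvgeZl.
have : ((normc (L f - L' f))%:E <= 0)%E.
  rewrite -(cvg_lim _ cv)//; apply: lime_ge.
    by apply/cvg_ex; exists 0%E.
  exact: nearW.
rewrite lee_fin => h; apply/eqP; rewrite -subr_eq0; apply/eqP.
by apply: ComplexField.Normc.eq0_normc; apply/eqP; rewrite eq_le h normc_ge0.
Qed.

Definition pairing_const : R := 2 * (2 * C ^+ 3) `^ q'^-1.

Lemma pairing_const_gt0 : 0 < pairing_const.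
Proof. by rewrite mulr_gt0// powR_gt0// mulr_gt0// exprn_gt0. Qed.

Let mu_setT_gt0 : (0 < mu setT)%E.
Proof.
apply: (lt_le_trans (mu_ball (point : X) ltr01).1); apply: le_measure; rewrite ?inE//.
exact: measurable_mball.
Qed.

(** [Lnorm] at [+oo] is an essential supremum only when the whole space has positive measure;
    otherwise it is 0 by convention. *)
Let NooE g : Noo g = ess_sup mu (fun x => `|Cq mu q' alpha g x|%E).
Proof. by rewrite /tent_norm unlock /Lnorm mu_setT_gt0. Qed.

Lemma tent_normoo_ge0 g : (0 <= Noo g)%E. Proof. exact: Lnorm_ge0. Qed.

(** A ball has positive measure, so it contains a point x where the essential bound on [Cq] holds;
    the ball is one of those in the supremum at x. Thus no ball is exceptional. *)
Lemma tent_normoo_tent g (G : R) : 0 <= G -> (Noo g <= G%:E)%E ->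
  forall (y : X) (r : R), 0 < r ->
  (\int[m]_(p in tent alpha (ball y r)) (normc (g p) `^ q')%:E <=
     (G `^ q')%:E * mu (ball y r))%E.
Proof.
move=> G0; rewrite NooE => /ess_supP aeG y r r0.
have [mB0 mBoo] := mu_ball y r0.
have [x [Bx xG]] : exists x : X, ball y r x /\ (`|Cq mu q' alpha g x| <= G%:E)%E.
  apply: contrapT => abs; have : mu.-negligible (ball y r : set (borel X)).
    apply: negligibleS aeG => x Bx /= xG; apply: abs; exists x; split => //.
  move=> /(measure_negligible (measurable_mball y r)) h.
  by move: mB0; rewrite h ltxx.
set I := (\int[m]_(p in _) _)%E.
have I0 : (0 <= I)%E by apply: integral_ge0 => p _; rewrite lee_fin powR_ge0.
have mBfin : mu (ball y r) \is a fin_num by rewrite ge0_fin_numE.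
have fmB : 0 < fine (mu (ball y r)) by rewrite fine_gt0// mB0 mBoo.
have h1 : ((I / mu (ball y r)) `^ q'^-1 <= G%:E)%E.
  apply: le_trans xG; rewrite (le_trans _ (lee_abs _))//.
  by apply: ereal_sup_ubound; exists (y, r).
have mBV : ((mu (ball y r))^-1 = (fine (mu (ball y r)))^-1%:E)%E.
  by rewrite -[in LHS](fineK mBfin) inver gt_eqF.
have h2 : (I / mu (ball y r) <= (G `^ q')%:E)%E.
  have IV0 : (0 <= I / mu (ball y r))%E.
    by rewrite mBV mule_ge0// lee_fin invr_ge0 ltW.
  have -> : (I / mu (ball y r) = ((I / mu (ball y r)) `^ q'^-1) `^ q')%E.
    by rewrite -poweRrM mulVf ?gt_eqF// poweRe1.
  rewrite -poweR_EFin; apply: gt0_ler_poweR => //.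
  - exact: ltW.
  - by rewrite in_itv/= leey poweR_ge0.
  - by rewrite in_itv/= leey andbT lee_fin.
have -> : I = (I / mu (ball y r) * mu (ball y r))%E.
  rewrite -muleA mBV -[in X in (_ * X)%E](fineK mBfin) -EFinM mulVf ?gt_eqF//.
  by rewrite mule1.
by apply: lee_wpmul2r.
Qed.

Lemma tent_normoo_le g (G : R) : 0 <= G ->
  (forall (y : X) (r : R), 0 < r ->
    (\int[m]_(p in tent alpha (ball y r)) (normc (g p) `^ q')%:E <=
     (G `^ q')%:E * mu (ball y r))%E) -> (Noo g <= G%:E)%E.
Proof.
move=> G0 gG; rewrite NooE; apply/ess_supP/aeW => x.
have H0 : (0 <= Cq mu q' alpha g x)%E.
  (* Any ball around x shows that the supremum is taken over a nonempty set of nonnegative values;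
     the unit ball serves. *)
  have bx : ball (x : X) 1 (x : X) by exact: ballxx.
  apply: (@le_trans _ _ (((\int[m]_(p in tent alpha (ball (x : X) 1))
     (normc (g p) `^ q')%:E) / mu (ball (x : X) 1)) `^ q'^-1)%E); first exact: poweR_ge0.
  by apply: ereal_sup_ubound; exists (x : X, 1).
rewrite gee0_abs//; apply: ge_ereal_sup => _ [[y r] /= [r0 yx] <-].
have [mB0 mBoo] := mu_ball y r0.
have mBfin : mu (ball y r) \is a fin_num by rewrite ge0_fin_numE.
have fmB : 0 < fine (mu (ball y r)) by rewrite fine_gt0// mB0 mBoo.
set I := (\int[m]_(p in _) _)%E.
have I0 : (0 <= I)%E by apply: integral_ge0 => p _; rewrite lee_fin powR_ge0.
have mBV : ((mu (ball y r))^-1 = (fine (mu (ball y r)))^-1%:E)%E.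
  by rewrite -[in LHS](fineK mBfin) inver gt_eqF.
have IV0 : (0 <= I / mu (ball y r))%E.
  by rewrite mBV mule_ge0// lee_fin invr_ge0 ltW.
have -> : (G%:E = ((G `^ q')%:E) `^ q'^-1)%E.
  by rewrite poweR_EFin -powRrM mulfV ?gt_eqF// powRr1.
apply: gt0_ler_poweR => //.
- by rewrite invr_ge0 ltW.
- by rewrite in_itv/= leey IV0.
- by rewrite in_itv/= leey lee_fin powR_ge0.
- rewrite mBV lee_pdivrMr// fineK//; exact: gG.
Qed.

Lemma pairing_abs_le g (G : R) f : 0 < G -> cmeasurable hs g -> (Noo g <= G%:E)%E ->
  cmeasurable hs f ->
  (\int[m]_(p in hs) (normc (f p * conjc (g p)))%:E <=
    (pairing_const * G)%:E * N1 f)%E.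
Proof.
move=> G0 mg gG mf; rewrite tent_norm1E.
have := @tent_duality_le R X mu alpha mu_ball alpha_gt0 C q q' G
  (fun p => normc (f p)) (fun p => normc (g p)) C_gt0 mu_doubling q_gt0 q'_gt0
  (conjugate_sum q_gt1) G0 (cmeasurable_normc mf) (cmeasurable_normc mg)
  (fun p _ => normc_ge0 _) (fun p _ => normc_ge0 _)
  (tent_normoo_tent (ltW G0) gG).
apply: le_trans; rewrite le_eqVlt; apply/orP; left; apply/eqP.
by apply: eq_integral => p _; rewrite ComplexField.Normc.normcM normc_conjc.
Qed.

End tent_spaces_duality.

(** * The pairing as a functional, and the Carleson condition *)

Section pairing_functional.
Context {R : realType} {X : pmetricType R}
  (mu : {sigma_finite_measure set (borel X) -> \bar R}) (alpha q C : R).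
Hypothesis mu_ball : forall (x : X) (r : R), 0 < r ->
  (0 < mu (ball x r))%E /\ (mu (ball x r) < +oo)%E.
Hypothesis alpha_gt0 : 0 < alpha.
Hypothesis q_gt1 : 1 < q.
Hypothesis C_gt0 : 0 < C.
Hypothesis mu_doubling : forall (x : X) (r : R), 0 < r ->
  (mu (ball x (2 * r)) <= C%:E * mu (ball x r))%E.

Local Notation P := (borel X * measurableTypeR R)%type.
Local Notation hs := (@halfspace R X).
Local Notation m := (halfspace_measure mu).
Local Notation mhs := (@measurable_halfspace R X).
Local Notation q' := (q / (q - 1)).
Local Notation T1 := (tent_space mu 1%:E q alpha).
Local Notation Too := (tent_space mu +oo%E q' alpha).
Local Notation N1 := (tent_norm mu 1%:E q alpha).
Local Notation Noo := (tent_norm mu +oo%E q' alpha).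
Local Notation K := (@exhaust R X).
Local Notation kappa := (pairing_const q C).
Local Notation kappa_gt0 := (pairing_const_gt0 q C_gt0).
Implicit Types f g : P -> R[i].

Let q_gt0 : 0 < q. Proof. exact: lt_trans ltr01 q_gt1. Qed.
Let q'_gt0 : 0 < q'. Proof. exact: conjugate_gt0. Qed.

Lemma tent_spaceooP g : Too g <-> cmeasurable hs g /\ (Noo g < +oo)%E.
Proof. by split => [[? ? ?]|[[? ?] ?]]; do ?split. Qed.

Lemma pairingE f g : pairing mu f g = cintegral m hs (fun p => f p * conjc (g p)).
Proof. by []. Qed.

(** [level] must be positive for Chebyshev's inequality, so the bound G has to be positive even when
    the norm of g is 0. *)
Let tent_normoo_ltP g : Too g -> exists2 G : R, 0 < G & (Noo g <= G%:E)%E.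
Proof.
move=> /tent_spaceooP[_]; have := tent_normoo_ge0 mu alpha q g.
case: (Noo g) => // a; rewrite lee_fin => a0 _; exists (a + 1).
  by rewrite ltr_wpDl.
by rewrite lee_fin lerDl.
Qed.

Lemma pairing_converges_tent f g : Too g -> T1 f -> pairing_converges mu f g.
Proof.
move=> Tg /tent_space1P[mf finf]; have [G G0 gG] := tent_normoo_ltP Tg.
have /tent_spaceooP[mg _] := Tg.
apply: (le_lt_trans (pairing_abs_le mu_ball alpha_gt0 q_gt1 C_gt0 mu_doubling G0 mg gG mf)).
apply: lte_mul_pinfty; [|by []|exact: finf].
by rewrite lee_fin mulr_ge0 ?ltW ?kappa_gt0.
Qed.

Let pairing_cintegrable f g : Too g -> T1 f ->
  cintegrable m hs (fun p => f p * conjc (g p)).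
Proof.
move=> Tg Tf; apply: (cintegrable_normc mhs).
  have /tent_spaceooP[mg _] := Tg; have /tent_space1P[mf _] := Tf.
  exact: cmeasurableM_conj.
exact: pairing_converges_tent.
Qed.

Lemma pairing_le f g (G : R) : 0 < G -> (Noo g <= G%:E)%E -> Too g -> T1 f ->
  ((normc (pairing mu f g))%:E <= (2 * (kappa * G))%:E * N1 f)%E.
Proof.
move=> G0 gG /tent_spaceooP[mg _] /tent_space1P[mf _].
apply: (le_trans (normc_cintegral_le _ mhs (cmeasurableM_conj mf mg))).
rewrite [in leRHS]EFinM -muleA; apply: lee_wpmul2l; first by rewrite lee_fin.
exact: (pairing_abs_le mu_ball alpha_gt0 q_gt1 C_gt0 mu_doubling G0 mg gG mf).
Qed.

Lemma pairing_lin (a : R[i]) f1 f2 g : Too g -> T1 f1 -> T1 f2 ->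
  pairing mu (fun p => a * f1 p + f2 p) g = a * pairing mu f1 g + pairing mu f2 g.
Proof.
move=> Tg T1f1 T1f2; rewrite !pairingE.
rewrite -(cintegral_lin mhs a (pairing_cintegrable Tg T1f1) (pairing_cintegrable Tg T1f2)).
by congr cintegral; apply/funext => p; rewrite mulrDl mulrA.
Qed.

Lemma pairing_bounded_linear g : Too g ->
  bounded_linear_functional mu 1%:E q alpha (fun f => pairing mu f g).
Proof.
move=> Tg; have /tent_spaceooP[mg _] := Tg; split.
- move=> f1 f2 /tent_space1P[mf1 _] /tent_space1P[mf2 _] f12.
  have [m1 m1'] := cmeasurableM_conj mf1 mg.
  have [m2 m2'] := cmeasurableM_conj mf2 mg.
  congr Complex; congr fine; apply: ae_eq_integral.
  + exact: mhs.
  + exact/measurable_EFinP.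
  + exact/measurable_EFinP.
  + by apply: filterS f12 => p /= h hp; rewrite h.
  + exact: mhs.
  + exact/measurable_EFinP.
  + exact/measurable_EFinP.
  + by apply: filterS f12 => p /= h hp; rewrite h.
- by move=> a f1 f2 Tf1 Tf2; exact: pairing_lin.
- have [G G0 gG] := tent_normoo_ltP Tg; exists (2 * (kappa * G)) => f Tf.
  exact: pairing_le.
Qed.

Lemma bounded_onZ (n : nat) (c : R) (u : P -> R) : bounded_on (K n) u ->
  bounded_on (K n) (fun p => c * u p).
Proof.
move=> bu; have := bounded_on_lin c bu (bounded_on0 _ (K n)).
by under eq_fun do rewrite addr0.
Qed.

(* Tested on |g|^{q' - 2} g cut off to a tent, and rescaled to norm at most 1. *)
Lemma tent_normoo_le_functional g (B : R) : 0 < B -> cmeasurable hs g ->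
  (forall n f, admissible n f -> (N1 f <= 1)%E -> normc (pairing mu f g) <= B) ->
  (Noo g <= (2 * B)%:E)%E.
Proof.
move=> B0 mg gB; have B20 : 0 < 2 * B by rewrite mulr_gt0.
apply: (tent_normoo_le mu_ball q_gt1 (ltW B20)) => y r r0.
set T := tent alpha (ball y r).
have mT : measurable T by exact: measurable_tent.
have Ths : T `<=` hs by move=> p [].
have [mB0 mBoo] := mu_ball y r0.
have mBfin : mu (ball y r) \is a fin_num by rewrite ge0_fin_numE.
pose b := fine (mu (ball y r)).
have b0 : 0 < b by rewrite fine_gt0// mB0 mBoo.
pose gam (p : P) : R := normc (g p).
have mgam : measurable_fun hs gam by exact: cmeasurable_normc.
have gam0 p : 0 <= gam p by exact: normc_ge0.
pose w (p : P) : R := gam p `^ (q' - 2).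
have w0 p : 0 <= w p by exact: powR_ge0.
pose F (p : P) : R[i] := Complex (w p * complex.Re (g p)) (w p * complex.Im (g p)).
have mw : measurable_fun hs w by exact: (measurableT_comp (measurable_powR _)).
have mF : cmeasurable hs F by split; apply: measurable_funM => //; [exact: mg.1|exact: mg.2].
(* The cut of F makes the test function admissible; that of g makes the integral of |g|^q' over
   [A n] finite, so that half of it can be absorbed below. *)
pose A n := T `&` (cut_set F n `&` cut_set g n).
have mA n : measurable (A n).
  by apply: measurableI => //; apply: measurableI; exact: measurable_cut_set.
have AT n : A n `<=` T by move=> p [].
have AK n : A n `<=` K n by move=> p [_ [[]]].
have mphi : measurable_fun hs (fun p => (gam p `^ q')%:E).
  by apply/measurable_EFinP; exact: (measurableT_comp (measurable_powR _)).
have mphiA (D : set P) : D `<=` T -> measurable_fun D (fun p => (gam p `^ q')%:E).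
  by move=> DT; apply: measurable_funS mphi => //; [exact: mhs|move=> p /DT /Ths].
have boundA n : (\int[m]_(p in A n) (gam p `^ q')%:E <=
    ((2 * B) `^ q')%:E * mu (ball y r))%E.
  set I := (\int[m]_(p in _) _)%E.
  have I0 : (0 <= I)%E by apply: integral_ge0 => p _; rewrite lee_fin powR_ge0.
  have Ifin : I \is a fin_num.
    rewrite ge0_fin_numE//; apply: (@le_lt_trans _ _ ((n%:R `^ q')%:E * m (A n))%E).
      rewrite -integral_cst//; apply: ge0_le_integral => //.
      - by move=> p _; rewrite lee_fin powR_ge0.
      - exact: mphiA (@AT n).
      - move=> p [_ [_ [_ /= gn]]]; rewrite lee_fin.
        by apply: (ge0_ler_powR (ltW q'_gt0)); rewrite ?nnegrE.
    apply: lte_mul_pinfty; [by rewrite lee_fin powR_ge0|by []|].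
    apply: (le_lt_trans _ (measure_exhaust_fin mu_ball n)).
    by apply: le_measure; rewrite ?inE//; exact: measurable_exhaust.
  pose i := fine I.
  have i0 : 0 <= i by exact: fine_ge0.
  have IE : I = i%:E by rewrite fineK.
  (* With this value B lam^(1-q) = 1/2 and 2B lam = (2B)^q'. The bound i <= B s then reads i <= B
     lam b + i/2, that is, i <= (2B)^q' b. *)
  pose lam := (2 * B) `^ (q - 1)^-1.
  have lam0 : 0 < lam by exact: powR_gt0.
  (* The bound of [tent1_local] for the norm of F cut to [A n]; dividing by it yields a test
     function of norm at most 1. *)
  pose s := lam * b + lam `^ (1 - q) * i.
  have s0 : 0 < s by rewrite ltr_wpDr ?mulr_ge0 ?powR_ge0// mulr_gt0.
  have sV0 : 0 < s^-1 by rewrite invr_gt0.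
  pose f (p : P) : R[i] := Complex (s^-1 * (\1_(A n) p * complex.Re (F p)))
    (s^-1 * (\1_(A n) p * complex.Im (F p))).
  have af : admissible n f.
    have [bRe bIm] : admissible n (fun p => Complex (\1_(A n) p * complex.Re (F p))
        (\1_(A n) p * complex.Im (F p))).
      by apply: (admissible_cut mF (mA n)) => p [_ []].
    by split; exact: bounded_onZ.
  have normF p : normc (F p) = gam p `^ (q' - 1).
    have -> : F p = Complex (w p) 0 * g p.
      by rewrite /F; case: (g p) => u v /=; congr Complex; simpl; rewrite mul0r ?subr0 ?addr0.
    rewrite ComplexField.Normc.normcM normc_Complex_real ger0_norm// mulrC /w.
    rewrite -(mulr_powRB1 (gam0 p) (_ : 0 < q' - 1)) ?subr_gt0 ?conjugate_gt1//.
    by congr (_ * _ `^ _); lra.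
  have normf p : normc (f p) = s^-1 * (\1_(A n) p * gam p `^ (q' - 1)).
    have -> : f p = Complex (s^-1 * \1_(A n) p) 0 * F p.
      by rewrite /f; case: (F p) => u v /=; congr Complex; simpl;
        rewrite mul0r ?subr0 ?addr0 mulrA.
    rewrite ComplexField.Normc.normcM normc_Complex_real normF ger0_norm ?mulrA//.
    by rewrite mulr_ge0// ltW.
  pose phi (p : P) : R := \1_(A n) p * gam p `^ q'.
  have normqf : normcX q f = (fun p => (s^-1) `^ q * phi p).
    apply/funext => p; rewrite /normcX normf powRM; [|exact: ltW|by rewrite mulr_ge0 ?powR_ge0].
    congr (_ * _); rewrite /phi powRM ?powR_ge0// -powRrM conjugate_subM//.
    by congr (_ * _); rewrite indicE; case: (_ \in _); rewrite ?powR1// powR0// gt_eqF.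
  have mphin : measurable_fun hs phi.
    apply: measurable_funM; first exact: measurable_indic.
    exact: (measurableT_comp (measurable_powR _)).
  have phi0 z : hs z -> 0 <= phi z by move=> _; rewrite mulr_ge0// powR_ge0.
  have IphiE : (\int[m]_(p in hs) (phi p)%:E = I)%E.
    rewrite /I integral_mkcond [RHS]integral_mkcond; apply: eq_integral => p _.
    rewrite !patchE /phi indicE; case: (boolP (p \in A n)) => pA.
      by rewrite mul1r ifT// inE; apply: Ths; apply: (AT n); rewrite -inE.
    by rewrite mul0r; case: ifP.
  have Nf : (N1 f <= 1)%E.
    rewrite (tent_norm1E q mu_ball alpha_gt0) normqf.
    rewrite (tent1_scale mu_ball alpha_gt0 q_gt1 (ltW sV0) mphin phi0).
    have -> : (1 = (s^-1)%:E * s%:E)%E by rewrite -EFinM mulVf// gt_eqF.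
    apply: lee_wpmul2l; first by rewrite lee_fin ltW.
    have mBy := measurable_mball y r.
    apply: (le_trans (tent1_local mu_ball alpha_gt0 q_gt1 lam0 mBy mphin phi0 _)).
      (* By definition of the tent, its points are not seen from outside the ball. *)
      move=> x p nBx xp; rewrite /phi indicE memNset ?mul0r// => /AT -[hp nT].
      by apply: nT; exists x.
    by rewrite IphiE IE -(fineK mBfin) -!EFinM -EFinD.
  have pairE : pairing mu f g = Complex (s^-1 * i) 0.
    have fgE p : f p * conjc (g p) = Complex (s^-1 * phi p) 0.
      rewrite /f /F /phi; have : gam p = normc (g p) by [].
      rewrite /w; case: (g p) => u v /=; set c := gam p => cE.
      have c0 : 0 <= c by exact: gam0.
      have cq : c `^ q' = c `^ (q' - 2) * (u ^+ 2 + v ^+ 2).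
        have -> : u ^+ 2 + v ^+ 2 = c ^+ 2.
          by rewrite cE sqr_sqrtr// addr_ge0// sqr_ge0.
        rewrite -(mulr_powRB1 c0 q'_gt0).
        rewrite -(mulr_powRB1 c0 (_ : 0 < q' - 1)) ?subr_gt0 ?conjugate_gt1//.
        rewrite (_ : q' - 1 - 1 = q' - 2); last by lra.
        by rewrite expr2 mulrA mulrC.
      by rewrite cq; congr Complex; simpl; ring.
    rewrite pairingE /cintegral; congr Complex.
      under eq_Rintegral do rewrite fgE /=.
      rewrite RintegralZl; last 2 first.
      - exact: mhs.
      - apply/integrableP; split; first exact/measurable_EFinP.
        under eq_integral do rewrite gee0_abs ?lee_fin ?mulr_ge0 ?powR_ge0//.
        by rewrite IphiE IE ltry.
      by rewrite /Rintegral IphiE.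
    under eq_Rintegral do rewrite fgE /=.
    by rewrite /Rintegral integral0.
  have := gB n f af Nf; rewrite pairE normc_Complex_real ger0_norm; last first.
    by rewrite mulr_ge0// ltW.
  rewrite mulrC ler_pdivrMr// /s mulrDr => h.
  have lamq : lam `^ (1 - q) = (2 * B)^-1.
    rewrite /lam -powRrM (_ : (q - 1)^-1 * (1 - q) = -1); last first.
      by rewrite -[1 - q]opprB mulrN mulVf// gt_eqF// subr_gt0.
    by rewrite powR_inv1// ltW.
  have lamB : 2 * B * lam = (2 * B) `^ q'.
    rewrite /lam -(conjugate_addV q_gt1) powRD; last by rewrite (gt_eqF B20) implybT.
    by rewrite powRr1// ltW.
  have h2 : B * (lam `^ (1 - q) * i) = i / 2.
    by rewrite lamq; field; rewrite gt_eqF.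
  rewrite IE -(fineK mBfin) -EFinM lee_fin -lamB -/b.
  by move: h; rewrite h2; lra.
have TA : T = \bigcup_n A n.
  apply/seteqP; split => [p Tp|p [n _ []]//].
  exists (maxn (depth p).+1 (maxn (Num.truncn (normc (F p))).+1
    (Num.truncn (normc (g p))).+1)) => //.
  set N := maxn _ _.
  have KN : K N p by apply: exhaustS (halfspace_exhaust (Ths _ Tp)); exact: leq_maxl.
  split => //; split; split => //=.
    rewrite (le_trans (ltW (truncnS_gt _)))// ler_nat.
    by rewrite /N maxnCA leq_maxl.
  rewrite (le_trans (ltW (truncnS_gt _)))// ler_nat.
  by rewrite /N !maxnA leq_maxr.
have ndA : nondecreasing_seq A.
  move=> i j ij; rewrite subsetEset => p [Tp [[KF Fi] [Kg gi]]].
  have ijR : i%:R <= j%:R :> R by rewrite ler_nat.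
  split => //; split; split; try exact: exhaustS KF.
    exact: le_trans ijR.
  exact: le_trans ijR.
have cvA := @ge0_nondecreasing_set_cvg_integral _ _ _ A
  (fun p => (gam p `^ q')%:E) m ndA mA (fun n => mphiA _ (@AT n))
  (fun n p _ => ltac:(by rewrite lee_fin powR_ge0)).
rewrite [X in integral _ X _]TA -(cvg_lim _ cvA)//.
apply: lime_le; first by apply/cvg_ex; eexists; exact: cvA.
exact: nearW.
Qed.

End pairing_functional.

(** * Representation of the functionals *)

Section representation.
Context {R : realType} {X : pmetricType R}
  (mu : {sigma_finite_measure set (borel X) -> \bar R}) (alpha q C : R).
Hypothesis mu_ball : forall (x : X) (r : R), 0 < r ->
  (0 < mu (ball x r))%E /\ (mu (ball x r) < +oo)%E.
Hypothesis alpha_gt0 : 0 < alpha.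
Hypothesis q_gt1 : 1 < q.
Hypothesis C_gt0 : 0 < C.
Hypothesis mu_doubling : forall (x : X) (r : R), 0 < r ->
  (mu (ball x (2 * r)) <= C%:E * mu (ball x r))%E.

Local Notation P := (borel X * measurableTypeR R)%type.
Local Notation hs := (@halfspace R X).
Local Notation m := (halfspace_measure mu).
Local Notation mhs := (@measurable_halfspace R X).
Local Notation q' := (q / (q - 1)).
Local Notation T1 := (tent_space mu 1%:E q alpha).
Local Notation Too := (tent_space mu +oo%E q' alpha).
Local Notation N1 := (tent_norm mu 1%:E q alpha).
Local Notation Noo := (tent_norm mu +oo%E q' alpha).
Local Notation K := (@exhaust R X).
Implicit Types (f g : P -> R[i]) (u : P -> R).

(** Radon-Nikodym is applied to real charges, so L is studied on real functions and recovered on f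
    from complex linearity and f = Re f + i Im f. *)
Let emb u (p : P) : R[i] := Complex (u p) 0.

Let admissible_emb n u : bounded_on (K n) u -> admissible n (emb u).
Proof. by move=> bu; split => //; exact: bounded_on0. Qed.

Let T1_emb n u : bounded_on (K n) u -> T1 (emb u).
Proof.
by move=> /admissible_emb; exact: (admissible_tent_space1 mu_ball alpha_gt0 q_gt1).
Qed.

Section functional.
Variable L : (P -> R[i]) -> R[i].
Hypothesis bL : bounded_linear_functional mu 1%:E q alpha L.

Let L_lin (a : R[i]) f g : T1 f -> T1 g -> L (fun z => a * f z + g z) = a * L f + L g.
Proof. by move: bL => [_ h _]; exact: h. Qed.

Let L_emb_lin n (a : R) u v : bounded_on (K n) u -> bounded_on (K n) v ->
  L (emb (fun p => a * u p + v p)) = Complex a 0 * L (emb u) + L (emb v).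
Proof.
move=> bu bv; rewrite -(L_lin _ (T1_emb bu) (T1_emb bv)); congr L.
by apply/funext => p; rewrite /emb; congr Complex; simpl; ring.
Qed.

Let L0 : L (emb (cst 0)) = 0.
Proof.
have T0 := T1_emb (bounded_on0 R (K 0)).
have -> : emb (cst 0) = (fun z => -1 * emb (cst 0) z + emb (cst 0) z).
  by apply/funext => p; rewrite mulN1r addNr.
by rewrite (L_lin _ T0 T0) mulN1r addNr.
Qed.

Let L_emb_ae n u : bounded_on (K n) u -> ae_eq m setT u (cst 0) -> L (emb u) = 0.
Proof.
move=> bu u0; rewrite -L0; move: bL => [h _ _]; apply: h.
- exact: (T1_emb bu).
- exact: (T1_emb (bounded_on0 R (K n))).
- by apply: filterS u0 => p /(_ Logic.I) up _; rewrite /emb up.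
Qed.

(** Dominated pointwise convergence to 0 implies convergence in the tent norm, and L is bounded for
    it; this is the source of countable additivity. *)
Let L_emb_cvg n (f_ : nat -> P -> R) F : bounded_on (K n) F ->
  (forall n, measurable_fun setT (f_ n)) -> (forall n p, `|f_ n p| <= F p) ->
  (forall p, f_ n p @[n --> \oo] --> 0) -> normc (L (emb (f_ n))) @[n --> \oo] --> 0.
Proof.
move=> bF mf_ fF f0.
have F0 p : 0 <= F p by apply: le_trans (fF 0%N p).
have bf k : bounded_on (K n) (f_ k).
  by apply: (le_bounded_on (mf_ k) bF) => p; rewrite [leRHS]ger0_norm.
have cv : (N1 (emb (f_ k)) @[k --> \oo] --> 0)%E.
  apply: (tent_norm1_cvg0 mu_ball alpha_gt0 q_gt1 _ (T1_emb bF)).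
  - by move=> k; exact: admissible_cmeasurable (admissible_emb (bf k)).
  - by move=> k p _; rewrite !normc_Complex_real [leRHS]ger0_norm.
  - move=> p _; under eq_fun do rewrite normc_Complex_real.
    by have := cvg_norm (f0 p); rewrite normr0; exact.
move: bL => [_ _ [B LB]].
have cvB : (`|B|%:E * N1 (emb (f_ k)) @[k --> \oo] --> 0)%E.
  by rewrite -(mule0 `|B|%:E); exact: cvgeZl.
suff : ((normc (L (emb (f_ k))))%:E @[k --> \oo] --> 0)%E by move=> /fine_cvgP[_].
apply: (squeeze_cvge _ (cvg_cst 0%E) cvB).
apply: nearW => k; rewrite lee_fin normc_ge0/=.
apply: (le_trans (LB _ (T1_emb (bf k)))); apply: lee_wpmul2r.
  exact: tent_norm1_ge0.
by rewrite lee_fin ler_norm.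
Qed.

(** Used with pi the real and the imaginary part: real linearity and |pi z| <= |z| carry the
    properties of L over to a real functional. *)
Let component_density (pi : R[i] -> R) : pi 0 = 0 ->
  (forall (a : R) z w, pi (Complex a 0 * z + w) = a * pi z + pi w) ->
  (forall z, `|pi z| <= normc z) ->
  exists2 h : P -> R, measurable_fun setT h &
  forall n u, bounded_on (K n) u ->
    m.-integrable setT (fun p => (u p * h p)%:E) /\
    pi (L (emb u)) = \int[m]_p (u p * h p).
Proof.
move=> pi0 pilin pile.
apply: (@functional_density_glue _ _ R m hs (@depth R X) _ (fun u => pi (L (emb u)))).
- exact: measurable_depth.
- by move=> n a u v bu bv; rewrite (L_emb_lin a bu bv) pilin.
- by move=> n u bu u0; rewrite (L_emb_ae bu u0).
- move=> n f_ F bF mf_ fF f0; apply/cvgr0Pnorm_le => e e0.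
  have /cvgr0Pnorm_le/(_ _ e0) := L_emb_cvg bF mf_ fF f0.
  apply: filterS => k; rewrite ger0_norm ?normc_ge0//; apply: le_trans.
  exact: pile.
Qed.

Let Rintegral_halfspace n u (h : P -> R) : bounded_on (K n) u ->
  \int[m]_p (u p * h p) = \int[m]_(p in hs) (u p * h p).
Proof.
move=> bu; rewrite [RHS]Rintegral_mkcond; apply: eq_Rintegral => p _.
rewrite patchE; case: ifPn => // /negP; rewrite inE => nhp.
by rewrite (bounded_on_out bu) ?mul0r// => /exhaust_hs.
Qed.

Lemma admissible_representation : exists2 g, cmeasurable hs g &
  forall n f, admissible n f -> L f = pairing mu f g.
Proof.
have [h1 mh1 H1] : exists2 h : P -> R, measurable_fun setT h &
    forall n u, bounded_on (K n) u ->
    m.-integrable setT (fun p => (u p * h p)%:E) /\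
    complex.Re (L (emb u)) = \int[m]_p (u p * h p).
  apply: component_density => //; last exact: normr_Re_le.
  by move=> a [x y] [z w] /=; rewrite mul0r subr0.
have [h2 mh2 H2] : exists2 h : P -> R, measurable_fun setT h &
    forall n u, bounded_on (K n) u ->
    m.-integrable setT (fun p => (u p * h p)%:E) /\
    complex.Im (L (emb u)) = \int[m]_p (u p * h p).
  apply: component_density => //; last exact: normr_Im_le.
  by move=> a [x y] [z w] /=; rewrite mul0r addr0.
(* The minus sign undoes the conjugation of g in the pairing: L has density h1 + i h2. *)
exists (fun p => Complex (h1 p) (- h2 p)).
  split; first exact: measurable_funTS.
  by apply: measurable_funTS; exact: measurableT_comp mh2.
move=> n f [bRe bIm].
pose a p := complex.Re (f p); pose b p := complex.Im (f p).
have fE : f = (fun z => Complex 0 1 * emb b z + emb a z).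
  apply/funext => p; rewrite /emb /a /b; case: (f p) => x y /=.
  by congr Complex; simpl; ring.
have LE u : bounded_on (K n) u -> L (emb u) =
    Complex (\int[m]_(p in hs) (u p * h1 p)) (\int[m]_(p in hs) (u p * h2 p)).
  move=> bu; rewrite -!(Rintegral_halfspace _ bu).
  by rewrite -(H1 _ _ bu).2 -(H2 _ _ bu).2; case: (L _).
have ihs u (h : P -> R) : m.-integrable setT (fun p => (u p * h p)%:E) ->
    m.-integrable hs (EFin \o (fun p => u p * h p)).
  by move=> i; apply: integrableS i => //; exact: mhs.
have ia1 := ihs _ _ (H1 _ _ bRe).1. have ia2 := ihs _ _ (H2 _ _ bRe).1.
have ib1 := ihs _ _ (H1 _ _ bIm).1. have ib2 := ihs _ _ (H2 _ _ bIm).1.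
rewrite {1}fE (L_lin _ (T1_emb bIm) (T1_emb bRe)) (LE _ bIm) (LE _ bRe).
have -> : pairing mu f (fun p => Complex (h1 p) (- h2 p)) = Complex
    (\int[m]_(p in hs) (a p * h1 p - b p * h2 p))
    (\int[m]_(p in hs) (a p * h2 p + b p * h1 p)).
  by congr Complex; apply: eq_Rintegral => p _; rewrite /a /b;
    case: (f p) => x y /=; ring.
rewrite RintegralB//; [|exact: mhs].
rewrite RintegralD//; [|exact: mhs].
by congr Complex; simpl; ring.
Qed.

End functional.

(** The difference h = g - g' is tested against itself, cut to [cut_set h n]. Both pairings converge
    absolutely, so they may be subtracted under the integral, and |h|^2 integrates to 0 over each
    such set. *)
Lemma pairing_inj g g' : Too g -> Too g' ->
  (forall f, T1 f -> pairing mu f g = pairing mu f g') ->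
  g = g' %[ae m in hs].
Proof.
move=> Tg Tg' gg'.
have /tent_spaceooP[mg _] := Tg; have /tent_spaceooP[mg' _] := Tg'.
pose h p := -1 * g' p + g p.
have mh : cmeasurable hs h by exact: cmeasurable_lin.
suff h0 : forall n, {ae m, forall p, hs p -> \1_(cut_set h n) p * normc (h p) ^+ 2 = 0}.
  have := ae_foralln h0; apply: filterS => p h0p hp.
  pose N := maxn (depth p).+1 (Num.truncn (normc (h p))).+1.
  have : cut_set h N p.
    split; first by apply: exhaustS (halfspace_exhaust hp); exact: leq_maxl.
    rewrite /= (le_trans (ltW (truncnS_gt _)))// ler_nat; exact: leq_maxr.
  move=> cN; have := h0p N hp; rewrite indicE mem_set// mul1r => /eqP.
  rewrite expf_eq0/= => /eqP/ComplexField.Normc.eq0_normc; rewrite /h mulN1r addrC => /eqP.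
  by rewrite subr_eq0 => /eqP.
move=> n; set A := cut_set h n.
have mA : measurable A by exact: measurable_cut_set.
pose f (p : P) : R[i] := Complex (\1_A p * complex.Re (h p)) (\1_A p * complex.Im (h p)).
have af : admissible n f by exact: (admissible_cut mh mA).
have Tf : T1 f by exact: (admissible_tent_space1 mu_ball alpha_gt0 q_gt1 af).
have conv g0 (Tg0 : Too g0) : cintegrable m hs (fun p => f p * conjc (g0 p)).
  apply: (cintegrable_normc mhs).
    apply: cmeasurableM_conj; first exact: admissible_cmeasurable af.
    by have /tent_spaceooP[] := Tg0.
  exact: (pairing_converges_tent mu_ball alpha_gt0 q_gt1 C_gt0 mu_doubling Tg0 Tf).
have fhE p : f p * conjc (h p) = Complex (\1_A p * normc (h p) ^+ 2) 0.
  rewrite /f; case: (h p) => x y /=.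
  rewrite sqr_sqrtr ?addr_ge0 ?sqr_ge0//.
  by congr Complex; simpl; ring.
have int0 : cintegral m hs (fun p => f p * conjc (h p)) = 0.
  have -> : (fun p => f p * conjc (h p)) =
      (fun p => -1 * (f p * conjc (g' p)) + f p * conjc (g p)).
    apply/funext => p; rewrite /h; case: (f p) => ? ?; case: (g p) => ? ?.
    by case: (g' p) => ? ?; congr Complex; simpl; ring.
  rewrite (cintegral_lin mhs _ (conv _ Tg') (conv _ Tg)) -!pairingE gg'//.
  by rewrite mulN1r addNr.
pose k p := \1_A p * normc (h p) ^+ 2.
have mk : measurable_fun hs (EFin \o k).
  apply/measurable_EFinP; apply: measurable_funM; first exact: measurable_indic.
  by apply: measurable_funX; exact: cmeasurable_normc.
have k0 p : 0 <= k p by rewrite mulr_ge0// sqr_ge0.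
have kint : \int[m]_(p in hs) k p = 0.
  transitivity (complex.Re (cintegral m hs (fun p => f p * conjc (h p)))).
    by apply: eq_Rintegral => p _; rewrite fhE.
  by rewrite int0.
(* A real-valued integral is also 0 when the extended one is [+oo], so [kint] becomes conclusive
   only with finiteness, here from k <= n^2 on a set of finite measure. *)
have kfin : (\int[m]_(p in hs) (k p)%:E < +oo)%E.
  apply: (@le_lt_trans _ _ (\int[m]_(p in hs) (n%:R ^+ 2 * \1_(K n) p)%:E)%E).
    apply: ge0_le_integral => //; first exact: mhs.
    - by move=> p _; rewrite lee_fin.
    - apply/measurable_EFinP; apply: measurable_funM => //.
      by apply: measurable_indic; exact: measurable_exhaust.
    - move=> p _; rewrite lee_fin /k indicE; case: (boolP (p \in A)) => [|_].
        rewrite inE => -[Kp /= hn]; rewrite indicE mem_set// mul1r mulr1.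
        by rewrite lerXn2r ?nnegrE ?normc_ge0 ?ler0n.
      by rewrite mul0r mulr_ge0// sqr_ge0.
  under eq_integral do rewrite EFinM.
  have mi : measurable_fun hs (fun p => (\1_(K n) p : R)%:E).
    by apply/measurable_EFinP; apply: measurable_indic; exact: measurable_exhaust.
  rewrite (ge0_integralZl _ mhs mi)//.
  rewrite integral_indic//; [|exact: mhs|exact: measurable_exhaust].
  rewrite setIidl; last exact: exhaust_hs.
  apply: lte_mul_pinfty; [by rewrite lee_fin sqr_ge0|by []|].
  exact: (measure_exhaust_fin mu_ball n).
have kint0 : (\int[m]_(p in hs) `|(EFin \o k) p| = 0)%E.
  under eq_integral do rewrite gee0_abs ?lee_fin//.
  have kfn : (\int[m]_(p in hs) (k p)%:E)%E \is a fin_num.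
    by rewrite ge0_fin_numE//; apply: integral_ge0 => p _; rewrite lee_fin.
  by rewrite -(fineK kfn); exact: (congr1 EFin kint).
have := (ae_eq_integral_abs m mhs mk).1 kint0.
by apply: filterS => p /= kp hp; have [] := kp hp.
Qed.

Lemma sigma_finite_duality :
  [/\ forall g, Too g ->
        (forall f, T1 f -> pairing_converges mu f g) /\
        bounded_linear_functional mu 1%:E q alpha (fun f => pairing mu f g),
      forall L, bounded_linear_functional mu 1%:E q alpha L ->
        exists g, [/\ Too g,
          forall f, T1 f -> L f = pairing mu f g &
          forall g', Too g' -> (forall f, T1 f -> L f = pairing mu f g') ->
            g = g' %[ae m in hs]] &
      exists c C : R, [/\ 0 < c, 0 < C & forall g, Too g ->
        let N := functional_norm mu 1%:E q alpha (fun f => pairing mu f g) in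
        (c%:E * Noo g <= N)%E /\ (N <= C%:E * Noo g)%E]].
Proof.
split.
- move=> g Tg; split.
    by move=> f Tf; exact: (pairing_converges_tent mu_ball alpha_gt0 q_gt1 C_gt0 mu_doubling Tg Tf).
  exact: (pairing_bounded_linear mu_ball alpha_gt0 q_gt1 C_gt0 mu_doubling Tg).
- move=> L bL; have [g mg Lg] := admissible_representation bL.
  have Tg : Too g.
    apply/tent_spaceooP; split; first exact: mg.
    move: (bL) => [_ _ [B LB]].
    (* The constant B of a bounded functional may be zero or negative; the test lemma wants a
       positive bound. *)
    have B0 : 0 < `|B| + 1 by rewrite ltr_wpDl.
    apply: (@le_lt_trans _ _ (2 * (`|B| + 1))%:E); last exact: ltry.
    apply: (tent_normoo_le_functional mu_ball alpha_gt0 q_gt1 B0 mg) => n f af Nf.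
    rewrite -(Lg _ _ af).
    have Tf := admissible_tent_space1 mu_ball alpha_gt0 q_gt1 af.
    rewrite -lee_fin; apply: (le_trans (LB _ Tf)).
    apply: (@le_trans _ _ (`|B|%:E * N1 f)%E).
      apply: lee_wpmul2r; first exact: tent_norm1_ge0.
      by rewrite lee_fin ler_norm.
    apply: (@le_trans _ _ (`|B|%:E * 1)%E); first exact: lee_wpmul2l.
    by rewrite mule1 lee_fin lerDl.
  have bP := pairing_bounded_linear mu_ball alpha_gt0 q_gt1 C_gt0 mu_doubling Tg.
  have LP := functional_eq_of_admissible mu_ball alpha_gt0 q_gt1 bL bP Lg.
  exists g; split; [exact: Tg|exact: LP|].
  move=> g' Tg' Lg'; apply: (pairing_inj Tg Tg') => f Tf.
  by rewrite -(LP f Tf) -(Lg' f Tf).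
pose kappa := pairing_const q C.
have kappa0 : 0 < kappa := pairing_const_gt0 q C_gt0.
(* 1/2 inverts the factor 2 of [tent_normoo_le_functional]; 2 kappa is the constant of
   [pairing_le]. *)
exists 2^-1, (2 * kappa); split; [by []|by rewrite mulr_gt0|].
move=> g Tg N; have /tent_spaceooP[mg gfin] := Tg.
have g0 := tent_normoo_ge0 mu alpha q g.
have gfn : Noo g \is a fin_num by rewrite ge0_fin_numE.
have T0 : T1 (emb (cst 0)) by exact: (T1_emb (bounded_on0 R (K 0))).
(* The zero function belongs to the unit ball of the tent space, so the supremum is nonnegative. *)
have N0 : (0 <= N)%E.
  apply: (@le_trans _ _ (normc (pairing mu (emb (cst 0)) g))%:E).
    by rewrite lee_fin normc_ge0.
  apply: ereal_sup_ubound; exists (emb (cst 0)) => //; split; first exact: T0.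
  rewrite (tent_norm1E q mu_ball alpha_gt0) /tent1 integral0_eq// => x _.
  rewrite /cone_integral integral0_eq ?poweR0r ?invr_neq0 ?gt_eqF ?(lt_trans ltr01)//.
  move=> p _; rewrite /normcX /emb normc_Complex_real normr0 powR0 ?mul0r//.
  by rewrite gt_eqF// (lt_trans ltr01).
split.
- have [Noo_|] := eqVneq N +oo%E; first by rewrite Noo_ leey.
  move=> Nfin; have NN : N \is a fin_num by rewrite ge0_fin_numE// lt_neqAle Nfin leey.
  (* The functional norm may be 0, and a positive bound is needed: e is added and then let go to
     0. *)
  apply/lee_addgt0Pr => e e0.
  have B0 : 0 < fine N + e by rewrite ltr_wpDl// fine_ge0.
  have : (Noo g <= (2 * (fine N + e))%:E)%E.
    apply: (tent_normoo_le_functional mu_ball alpha_gt0 q_gt1 B0 mg) => n f af Nf.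
    have Tf := admissible_tent_space1 mu_ball alpha_gt0 q_gt1 af.
    rewrite -lee_fin EFinD fineK//; apply: (@le_trans _ _ N); last by rewrite leeDl// lee_fin ltW.
    by apply: ereal_sup_ubound; exists f; [split; [exact: Tf|exact: Nf]|].
  rewrite -(fineK gfn) -(fineK NN) -EFinM -EFinD !lee_fin; lra.
- apply/lee_addgt0Pr => e e0.
  apply: ge_ereal_sup => _ [f [Tf Nf] <-].
  (* Positive even if the norm of g is 0; the excess contributes exactly e after multiplication by 2
     kappa. *)
  pose G := fine (Noo g) + e / (2 * kappa).
  have G0 : 0 < G by rewrite ltr_wpDl ?fine_ge0// divr_gt0// mulr_gt0.
  have gG : (Noo g <= G%:E)%E.
    by rewrite -(fineK gfn) lee_fin lerDl ltW// divr_gt0// mulr_gt0.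
  apply: (le_trans (pairing_le mu_ball alpha_gt0 q_gt1 C_gt0 mu_doubling G0 gG Tg Tf)).
  apply: (@le_trans _ _ ((2 * (kappa * G))%:E * 1)%E).
    apply: lee_wpmul2l; last exact: Nf.
    by rewrite lee_fin; apply: mulr_ge0 => //; apply: mulr_ge0; exact: ltW.
  rewrite mule1 -(fineK gfn) -EFinM -EFinD lee_fin mulrA /G mulrDr lerD2l.
  by rewrite mulrCA mulfV ?mulr1// gt_eqF// mulr_gt0.
Qed.

End representation.

(** * Sigma-finiteness from finite balls, and the duality theorem *)

Section sigma_finite_of_balls.
Context {R : realType} {X : pmetricType R}.
Variable mu : {measure set (borel X) -> \bar R}.
Hypothesis mu_fin : forall (x : X) (r : R), 0 < r -> (mu (ball x r) < +oo)%E.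

(* A copy of [mu] indexed by [mu_fin], as the key of a sigma-finite instance.  *)
Definition ball_finite_copy
    of (forall (x : X) (r : R), 0 < r -> (mu (ball x r) < +oo)%E) :
  set (borel X) -> \bar R := mu.

Let nu := ball_finite_copy mu_fin.

HB.instance Definition _ := Measure.copy nu mu.

Let nu_sigma_finite : sigma_finite setT nu.
Proof.
exists (fun n : nat => ball (point : X) (n.+1%:R : R) : set (borel X)).
  apply/seteqP; split => // x _; exists (Num.truncn (mdist (point : X) x)) => //.
  by rewrite ballEmdist; exact: truncnS_gt.
by move=> n; split; [exact: measurable_mball|exact: mu_fin].
Qed.

HB.instance Definition _ := @Measure_isSigmaFinite.Build _ _ _ nu nu_sigma_finite.

(** Balls of radius n + 1 about the base point exhaust X. An equality of measures allows [mu] to be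
    replaced by its sigma-finite copy in every notion built on it. *)
Lemma sigma_finite_of_balls :
  exists nu' : {sigma_finite_measure set (borel X) -> \bar R},
    mu = nu' :> {measure set (borel X) -> \bar R}.
Proof. by exists nu; apply: eq_measure. Qed.

End sigma_finite_of_balls.

Theorem proposition3p15 (R : realType) (X : pmetricType R)
    (mu : {measure set (borel X) -> \bar R})
    (mu_ball : forall (x : X) (r : R), 0 < r ->
       (0 < mu (ball x r))%E /\ (mu (ball x r) < +oo)%E)
    (mu_doubling : doubling mu)
    (alpha q : R) (alpha_gt0 : 0 < alpha) (q_gt1 : 1 < q) :
  let q' := q / (q - 1) in
  let T1 := tent_space mu 1%:E q alpha in
  let Too := tent_space mu +oo%E q' alpha in
  [/\ forall g, Too g ->
        (forall f, T1 f -> pairing_converges mu f g) /\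
        bounded_linear_functional mu 1%:E q alpha
          (fun f => pairing mu f g),
      forall L, bounded_linear_functional mu 1%:E q alpha L ->
        exists g, [/\ Too g,
          forall f, T1 f -> L f = pairing mu f g &
          forall g', Too g' -> (forall f, T1 f -> L f = pairing mu f g') ->
            g = g' %[ae halfspace_measure mu in halfspace (X := X)]] &
      exists c C : R, [/\ 0 < c, 0 < C & forall g, Too g ->
        let N := functional_norm mu 1%:E q alpha
          (fun f => pairing mu f g) in
        (c%:E * tent_norm mu +oo%E q' alpha g <= N)%E /\
        (N <= C%:E * tent_norm mu +oo%E q' alpha g)%E]].
Proof.
have mu_fin (x : X) (r : R) : 0 < r -> (mu (ball x r) < +oo)%E.
  by move=> r0; exact: (mu_ball x r r0).2.
have [nu munu] := sigma_finite_of_balls mu_fin.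
move: mu_ball mu_doubling; rewrite {mu_fin}munu => nu_ball [C C0 nu_doubling].
exact: (sigma_finite_duality nu_ball alpha_gt0 q_gt1 C0 nu_doubling).
Qed.
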